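(* Let $\mathbb{F}$ be a field. Let $\mathsf{SkTr}$ be the category of skew trusses and $\mathsf{HTr}$ the category of Hopf trusses in $\mathbb{F}\text{-}\mathsf{Vect}$. Let $\mathsf{P}_{st}:\mathsf{SkTr}\to\mathsf{HTr}$ be the linearization functor $\mathbb{T}\mapsto \mathbb{F}[T]$ and $\mathsf{R}_{ht}:\mathsf{HTr}\to\mathsf{SkTr}$ the functor taking a Hopf truss to the skew truss of its grouplike elements. Then $\mathsf{P}_{st}$ is left adjoint to $\mathsf{R}_{ht}$, $\mathsf{P}_{st}\dashv\mathsf{R}_{ht}$, and this adjunction induces an equivalence of categories between $\mathsf{SkTr}$ and the full subcategory of $\mathsf{HTr}$ whose objects are all pointed cosemisimple Hopf trusses.
   Context: **Skew trusses.** A skew truss $\mathbb{T}=(T_1,T_2,\omega_T)$ is a set $T$ with two binary operations $\diamond_1,\diamond_2$ and a map $\omega_T:T\to T$ such that $T_1=(T,\diamond_1)$ is a group (unit $1_{\diamond_1}$, inverse of $a$ denoted $a^{\diamond_1}$), $T_2=(T,\diamond_2)$ is a semigroup, and for all $a,b,c\in T$ $$a\diamond_2(b\diamond_1 c)=(a\diamond_2 b)\diamond_1\omega_T(a)^{\diamond_1}\diamond_1(a\diamond_2 c).$$ A morphism $\mathbb{T}\to\mathbb{S}$ is a map $T\to S$ that is a group morphism $T_1\to S_1$ and a semigroup morphism $T_2\to S_2$ (it then automatically satisfies $\omega_S\circ f=f\circ\omega_T$). **Hopf trusses in $\mathbb{F}\text{-}\mathsf{Vect}$.** Write $c$ for the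 usual flip and, in composites, write an object for its identity morphism. A non-unital bimonoid is a coassociative counital coalgebra $(B,\varepsilon_B,\delta_B)$ with an associative product $\mu_B:B\otimes B\to B$ (no unit required) which is a coalgebra morphism. A morphism of non-unital bimonoids is a multiplicative coalgebra morphism. A Hopf monoid is a Hopf algebra over $\mathbb{F}$, and morphisms of Hopf monoids are bialgebra morphisms. A Hopf truss $\mathbb{H}=(H_1,H_2,\sigma_H)$ consists of a coalgebra $(H,\varepsilon_H,\delta_H)$ together with $\eta_H,\mu_H^1,\mu_H^2,\lambda_H,\sigma_H$ such that $H_1=(H,\eta_H,\mu_H^1,\varepsilon_H,\delta_H,\lambda_H)$ is a Hopf monoid, $H_2=(H,\mu_H^2,\varepsilon_H,\delta_H)$ is a non-unital bimonoid, $\sigma_H:H\to H$ is a coalgebra morphism, and $$\mu_H^2\circ(H\otimes\mu_H^1)=\mu_H^1\circ(\mu_H^2\otimes\Gamma_{H_1}^{\sigma_H})\circ(H\otimes c_{H,H}\otimes H)\circ(\delta_H\otimes H\otimes H),$$ where $\Gamma_{H_1}^{\sigma_H}=\mu_H^1\circ((\lambda_H\circ\sigma_H)\otimes\mu_H^2)\circ(\delta_H\otimes H)$. A morphism of Hopf trusses $\mathbb{H}\to\mathbb{B}$ is a linear map $f:H\to B$ that is a Hopf monoid morphism $H_1\to B_1$ and a non-unital bimonoid morphism $H_2\to B_2$. **Pointed cosemisimple.** A coalgebra $C$ is pointed if its simple subcoalgebras are one-dimensional, and cosemisimple if it equals its coradical (the sum of its simple subcoalgebras). A Hopf truss is pointed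 cosemisimple if its underlying coalgebra $(H,\varepsilon_H,\delta_H)$ is pointed and cosemisimple. **The functors.** For a skew truss $\mathbb{T}$, $\mathsf{P}_{st}(\mathbb{T})$ is the Hopf truss on the free vector space $\mathbb{F}[T]=\bigoplus_{a\in T}\mathbb{F}a$ whose products $\mu^1,\mu^2$ are the linear extensions of $\diamond_1,\diamond_2$, with unit $1_{\diamond_1}$, coproduct $\delta(a)=a\otimes a$ and counit $\varepsilon(a)=1_{\mathbb{F}}$ for $a\in T$, antipode the linear extension of $a\mapsto a^{\diamond_1}$, and cocycle $\sigma_{\mathbb{F}[T]}$ the linear extension of $\omega_T$. On morphisms $\mathsf{P}_{st}$ is linear extension. For a Hopf truss $\mathbb{H}$ let $\mathsf{G}(H)=\{h\in H:\delta_H(h)=h\otimes h,\ \varepsilon_H(h)=1_{\mathbb{F}}\}$ be the set of grouplike elements. Then $\mathsf{R}_{ht}(\mathbb{H})$ is the skew truss on $\mathsf{G}(H)$ with $\diamond_1,\diamond_2$ the restrictions of $\mu_H^1,\mu_H^2$ and $\omega$ the restriction of $\sigma_H$. On morphisms $\mathsf{R}_{ht}(f)$ is the restriction of $f$ to grouplike elements. *)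

(* Defs.v *)
From HB Require Import structures.
From mathcomp Require Import all_boot all_order all_algebra.
From mathcomp Require Import boolp classical_sets.
From mathcomp Require Import finmap monalg.

Set Implicit Arguments.
Unset Strict Implicit.
Unset Printing Implicit Defensive.

Import GRing.Theory.
Local Open Scope classical_set_scope.
Local Open Scope ring_scope.

Section LinearAlgebra.
Variable F : fieldType.
Implicit Types U V W : lmodType F.

Definition is_subspace V (D : set V) : Prop :=
  D 0 /\ forall (a : F) x y, D x -> D y -> D (a *: x + y).

Definition lin_span V (S : set V) : set V :=
  [set v | exists s : seq (F * V),
     (forall p, p \in s -> S p.2) /\ v = \sum_(p <- s) p.1 *: p.2].

Lemma lin_span_subspace V (S : set V) : is_subspace (lin_span S).
Proof.
split=> [|a x y [s [sS ->]] [t [tS ->]]].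
  by exists [::]; rewrite big_nil.
exists ([seq (a * p.1, p.2) | p <- s] ++ t); split.
  by move=> p; rewrite mem_cat => /orP[/mapP[q /sS qS ->]|/tS].
rewrite big_cat big_map /=; congr (_ + _); rewrite scaler_sumr.
by apply: eq_bigr => p _; rewrite scalerA.
Qed.

Lemma sub_lin_span V (S : set V) : S `<=` lin_span S.
Proof.
move=> v Sv; exists [:: (1, v)]; split=> [p|]; first by rewrite inE => /eqP ->.
by rewrite big_seq1 scale1r.
Qed.

Lemma linear_span0 V W (f : {linear V -> W}) (S : set V) v :
  (forall w, S w -> f w = 0) -> lin_span S v -> f v = 0.
Proof.
move=> fS0 [s [sS ->]]; rewrite linear_sum big_seq big1 // => p ps.
by rewrite linearZ /= fS0 ?scaler0 //; exact: sS.
Qed.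

Lemma linear_ext U V (f g : {linear U -> V}) : f =1 g -> f = g.
Proof.
case: f g => [f cf] [g cg] /= fg; have {}fg : f = g by exact: funext.
subst g; congr GRing.Linear.Pack; case: cf cg => [[fa] [fb]] [[ga] [gb]].
by rewrite (Prop_irrelevance fa ga) (Prop_irrelevance fb gb).
Qed.

Definition free_lift (T : choiceType) V (f : T -> V) (g : {malg F[T]}) : V :=
  \sum_(k <- msupp g) g@_k *: f k.

Lemma free_lift_is_linear (T : choiceType) V (f : T -> V) :
  linear (free_lift f).
Proof.
have E (g : {malg F[T]}) (d : {fset T}) : (msupp g `<=` d)%fset ->
    free_lift f g = \sum_(k <- d) g@_k *: f k.
  move=> gd; rewrite /free_lift; apply: big_fset_incl => // k _ kg.
  by rewrite mcoeff_outdom // scale0r.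
move=> a g h; set d := (msupp g `|` msupp h)%fset.
have gd : (msupp g `<=` d)%fset by exact: fsubsetUl.
have hd : (msupp h `<=` d)%fset by exact: fsubsetUr.
rewrite (E _ _ gd) (E _ _ hd) (E _ d).
  rewrite scaler_sumr -big_split /=; apply: eq_bigr => k _.
  by rewrite mcoeffD mcoeffZ scalerDl scalerA.
apply: fsubset_trans (msuppD_le _ _) _; rewrite fsubUset hd andbT.
exact: fsubset_trans (msuppZ_le _ _) gd.
Qed.

HB.instance Definition _ (T : choiceType) V (f : T -> V) :=
  GRing.isLinear.Build F {malg F[T]} V *:%R (free_lift f)
    (free_lift_is_linear f).

Lemma free_liftU (T : choiceType) V (f : T -> V) t :
  free_lift f << t >> = f t.
Proof.
by rewrite /free_lift msuppU oner_eq0 big_seq_fset1 mcoeffUU scale1r.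
Qed.

Lemma free_eq (T : choiceType) V (f g : {linear {malg F[T]} -> V}) :
  (forall t, f << t >> = g << t >>) -> f =1 g.
Proof.
move=> fg x; rewrite [x]monalgE !linear_sum; apply: eq_bigr => k _.
suff -> : << x@_k *g k >> = x@_k *: (<< k >> : {malg F[T]}).
  by rewrite !linearZ /= fg.
by apply/malgP => k'; rewrite mcoeffZ !mcoeffU mulr_natr.
Qed.

Section Tensor.
Variables U V : lmodType F.

Local Notation free := {malg F[(U * V)%type]}.
Local Notation "[ u ; v ]" := (<< (u, v) >> : free).

(* U ⊗ V is the free vector space on U * V modulo the span of these relators *)
Inductive tensor_rel : set free :=
| Tensor_relDl u u' v : tensor_rel ([u + u'; v] - [u; v] - [u'; v])
| Tensor_relDr u v v' : tensor_rel ([u; v + v'] - [u; v] - [u; v'])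
| Tensor_relZl a u v : tensor_rel ([a *: u; v] - a *: [u; v])
| Tensor_relZr a u v : tensor_rel ([u; a *: v] - a *: [u; v]).

Definition tensor_null : free -> bool := fun x => `[< lin_span tensor_rel x >].

Lemma tensor_null_zmod : zmod_closed tensor_null.
Proof.
have [s0 sD] := lin_span_subspace tensor_rel.
split=> [|x y /asboolP xN /asboolP yN]; apply/asboolP => //.
by rewrite addrC -scaleN1r; exact: sD.
Qed.

HB.instance Definition _ :=
  GRing.isZmodClosed.Build free tensor_null tensor_null_zmod.

Definition tensor : Type := Quotient.quot (GRing.ZmodClosed.clone _ tensor_null _).

HB.instance Definition _ := GRing.Zmodule.on tensor.
HB.instance Definition _ := EqQuotient.on tensor.


Definition tensor_pi (x : free) : tensor := (\pi_tensor x)%qT.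

Lemma tensor_piD : {morph tensor_pi : x y / x + y}.
Proof. by move=> x y; rewrite /tensor_pi !piE. Qed.

Lemma tensor_pi_eq x y : tensor_pi x = tensor_pi y <-> lin_span tensor_rel (x - y).
Proof.
rewrite /tensor_pi; split=> [/eqP|xy]; last apply/eqP.
  by rewrite piE => /asboolP.
by rewrite piE; apply/asboolP.
Qed.

Definition tensor_scale (a : F) (t : tensor) : tensor :=
  tensor_pi (a *: repr t).

Lemma tensor_pi_surj t : tensor_pi (repr t) = t.
Proof. exact: reprK. Qed.

Lemma tensor_piZ a x : tensor_pi (a *: x) = tensor_scale a (tensor_pi x).
Proof.
apply/tensor_pi_eq; rewrite -scalerBr -[_ *: _]addr0.
have [s0 sD] := lin_span_subspace tensor_rel; apply: sD => //.
by apply/tensor_pi_eq; rewrite tensor_pi_surj.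
Qed.

Lemma tensor_scaleA a b t :
  tensor_scale a (tensor_scale b t) = tensor_scale (a * b) t.
Proof. by rewrite -[t]tensor_pi_surj -!tensor_piZ scalerA. Qed.

Lemma tensor_scale1 : left_id 1 tensor_scale.
Proof. by move=> t; rewrite -[t]tensor_pi_surj -!tensor_piZ scale1r. Qed.

Lemma tensor_scaleDr : right_distributive tensor_scale +%R.
Proof.
move=> a t t'; rewrite -[t]tensor_pi_surj -[t']tensor_pi_surj.
by rewrite -tensor_piD -!tensor_piZ scalerDr tensor_piD.
Qed.

Lemma tensor_scaleDl t :
  {morph tensor_scale^~ t : a b / a + b}.
Proof.
move=> a b /=; rewrite -[t]tensor_pi_surj.
by rewrite -!tensor_piZ scalerDl tensor_piD.
Qed.

HB.instance Definition _ := GRing.Zmodule_isLmodule.Build F tensor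
  tensor_scaleA tensor_scale1 tensor_scaleDr tensor_scaleDl.

Lemma tensor_pi_is_linear : linear tensor_pi.
Proof. by move=> a x y; rewrite tensor_piD tensor_piZ. Qed.

HB.instance Definition _ :=
  GRing.isLinear.Build F free tensor *:%R tensor_pi tensor_pi_is_linear.

End Tensor.
End LinearAlgebra.

HB.lock Definition tens (F : fieldType) (U V : lmodType F) (u : U) (v : V) :
    tensor U V :=
  tensor_pi << (u, v) >>.
Canonical tens_unlock := Unlockable tens.unlock.
Arguments tens {F U V} u v.

Section Tens.
Variables (F : fieldType) (U V : lmodType F).
Implicit Types (u : U) (v : V) (a : F).

Lemma tensDl u u' v : tens (u + u') v = tens u v + tens u' v.
Proof.
rewrite unlock -linearD /=; apply/tensor_pi_eq; rewrite opprD addrA.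
exact/sub_lin_span/Tensor_relDl.
Qed.

Lemma tensDr u v v' : tens u (v + v') = tens u v + tens u v'.
Proof.
rewrite unlock -linearD /=; apply/tensor_pi_eq; rewrite opprD addrA.
exact/sub_lin_span/Tensor_relDr.
Qed.

Lemma tensZl a u v : tens (a *: u) v = a *: tens u v.
Proof.
rewrite unlock -linearZ /=; apply/tensor_pi_eq; exact/sub_lin_span/Tensor_relZl.
Qed.

Lemma tensZr a u v : tens u (a *: v) = a *: tens u v.
Proof.
rewrite unlock -linearZ /=; apply/tensor_pi_eq; exact/sub_lin_span/Tensor_relZr.
Qed.

Lemma tensor_eq (W : lmodType F) (f g : {linear tensor U V -> W}) :
  (forall u v, f (tens u v) = g (tens u v)) -> f =1 g.
Proof.
move=> fg t; rewrite -[t]tensor_pi_surj.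
have := @free_eq _ _ _ (f \o @tensor_pi F U V) (g \o @tensor_pi F U V); apply=> -[u v].
by have := fg u v; rewrite unlock.
Qed.

Section Lift.
Variables (W : lmodType F) (b : U -> V -> W).

Definition bilin : Prop := (forall v, linear (b^~ v)) /\ forall u, linear (b u).

Definition tensor_lift_fun of bilin := fun t : tensor U V =>
  free_lift (fun p => b p.1 p.2) (repr t).

Variable bP : bilin.

Lemma free_lift_bilin x :
  free_lift (fun p => b p.1 p.2) x = tensor_lift_fun bP (tensor_pi x).
Proof.
have [bl br] := bP; set f := free_lift _; apply/eqP; rewrite -subr_eq0.
rewrite /tensor_lift_fun -/f -[_ - _]linearB; apply/eqP.
apply: (@linear_span0 _ _ _ f (@tensor_rel F U V)); last first.
  by apply/tensor_pi_eq; rewrite tensor_pi_surj.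
have Zl a u v : b (a *: u) v = a *: b u v.
  have b0 : b 0 v = 0.
    by have := bl v (-1) 0 0; rewrite scaler0 addr0 scaleN1r addNr.
  by have := bl v a u 0; rewrite addr0 b0 addr0.
have Zr a u v : b u (a *: v) = a *: b u v.
  have b0 : b u 0 = 0.
    by have := br u (-1) 0 0; rewrite scaler0 addr0 scaleN1r addNr.
  by have := br u a v 0; rewrite addr0 b0 addr0.
have Dl u u' v : b (u + u') v = b u v + b u' v.
  by have := bl v 1 u u'; rewrite !scale1r.
have Dr u v v' : b u (v + v') = b u v + b u v'.
  by have := br u 1 v v'; rewrite !scale1r.
move=> w []; rewrite /f; move=> *; rewrite !linearB ?linearZ /= !free_liftU /=.
- by rewrite Dl addrAC addrK subrr.
- by rewrite Dr addrAC addrK subrr.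
- by rewrite Zl scalerN subrr.
- by rewrite Zr scalerN subrr.
Qed.

Lemma tensor_lift_is_linear : linear (tensor_lift_fun bP).
Proof.
move=> a s t; rewrite -[s]tensor_pi_surj -[t]tensor_pi_surj -linearP.
by rewrite -!free_lift_bilin linearP.
Qed.

HB.instance Definition _ := GRing.isLinear.Build F (tensor U V) W *:%R
  (tensor_lift_fun bP) tensor_lift_is_linear.

End Lift.
End Tens.

HB.lock Definition tensor_lift (F : fieldType) (U V W : lmodType F)
    (b : U -> V -> W) (bP : bilin b) : {linear tensor U V -> W} :=
  tensor_lift_fun bP.
Canonical tensor_lift_unlock := Unlockable tensor_lift.unlock.
Arguments tensor_lift {F U V W b} bP.

(* tensor_lift bP is the linear map on the tensor product induced by b *)
Lemma tensor_liftE (F : fieldType) (U V W : lmodType F) (b : U -> V -> W)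
  (bP : bilin b) u v : tensor_lift bP (tens u v) = b u v.
Proof. by rewrite tensor_lift.unlock tens.unlock /= -free_lift_bilin free_liftU. Qed.

Notation "U ⊗ V" := (tensor U V) (at level 40, left associativity) : type_scope.
Notation "u ⊗ᵥ v" := (tens u v) (at level 40, left associativity) : ring_scope.

Section TensorMaps.
Variable F : fieldType.
Implicit Types U V W X : lmodType F.

Lemma bilin_tens U V : bilin (@tens F U V).
Proof.
by split=> [v a u u'|u a v v']; rewrite ?tensDl ?tensDr ?tensZl ?tensZr.
Qed.

Section Slices.
Variables (U V W : lmodType F) (h : {linear U ⊗ V -> W}).

Definition slicel (v : V) (u : U) : W := h (u ⊗ᵥ v).
Definition slicer (u : U) (v : V) : W := h (u ⊗ᵥ v).

Lemma slicel_is_linear v : linear (slicel v).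
Proof. by move=> a x y; rewrite /slicel (bilin_tens _ _).1 linearP. Qed.

Lemma slicer_is_linear u : linear (slicer u).
Proof. by move=> a x y; rewrite /slicer (bilin_tens _ _).2 linearP. Qed.

HB.instance Definition _ v :=
  GRing.isLinear.Build F U W *:%R (slicel v) (slicel_is_linear v).
HB.instance Definition _ u :=
  GRing.isLinear.Build F V W *:%R (slicer u) (slicer_is_linear u).

Lemma slicelE v u : slicel v u = h (u ⊗ᵥ v). Proof. by []. Qed.
Lemma slicerE u v : slicer u v = h (u ⊗ᵥ v). Proof. by []. Qed.

End Slices.

Lemma tensor_eq3 U V W X (f g : {linear (U ⊗ V) ⊗ W -> X}) :
  (forall u v w, f (u ⊗ᵥ v ⊗ᵥ w) = g (u ⊗ᵥ v ⊗ᵥ w)) -> f =1 g.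
Proof.
move=> fg; apply: tensor_eq => x w.
by apply: (@tensor_eq _ _ _ _ (slicel f w) (slicel g w)) => u v; exact: fg.
Qed.

Lemma tensor_eq3r U V W X (f g : {linear U ⊗ (V ⊗ W) -> X}) :
  (forall u v w, f (u ⊗ᵥ (v ⊗ᵥ w)) = g (u ⊗ᵥ (v ⊗ᵥ w))) -> f =1 g.
Proof.
move=> fg; apply: tensor_eq => u x.
by apply: (@tensor_eq _ _ _ _ (slicer f u) (slicer g u)) => v w; exact: fg.
Qed.

Lemma bilin_comp U V U' V' W (b : U' -> V' -> W) (f : {linear U -> U'})
  (g : {linear V -> V'}) : bilin b -> bilin (fun u v => b (f u) (g v)).
Proof. by move=> [bl br]; split=> [v|u] a x y; rewrite linearP ?bl ?br. Qed.

Lemma bilin_flip U V W (b : U -> V -> W) : bilin b -> bilin (fun v u => b u v).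
Proof. by case. Qed.

Lemma bilin_lift U V W X (b : W -> U -> V -> X) (bP : forall w, bilin (b w)) :
  (forall u v, linear (fun w => b w u v)) ->
  bilin (fun t w => tensor_lift (bP w) t).
Proof.
move=> bl; split=> [w a x y|t a w w']; first by rewrite linearP.
pose r := (fun x : U ⊗ V =>
  a *: tensor_lift (bP w) x + tensor_lift (bP w') x) : U ⊗ V -> X.
have rl : linear r.
  move=> c x y; rewrite /r [tensor_lift (bP w) _]linearP.
  rewrite [tensor_lift (bP w') _]linearP !scalerDr !scalerA (mulrC c a).
  by rewrite addrACA.
pose lr := HB.pack_for {linear U ⊗ V -> X} r
  (GRing.isLinear.Build F _ _ *:%R r rl).
apply: (@tensor_eq _ _ _ _ (tensor_lift (bP (a *: w + w'))) lr) => u v.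
by rewrite /= /r !tensor_liftE bl.
Qed.

Definition tensor_map U V U' V' (f : {linear U -> U'}) (g : {linear V -> V'}) :
    {linear U ⊗ V -> U' ⊗ V'} :=
  tensor_lift (bilin_comp f g (bilin_tens U' V')).

Lemma tensor_mapE U V U' V' (f : {linear U -> U'}) (g : {linear V -> V'}) u v :
  tensor_map f g (u ⊗ᵥ v) = f u ⊗ᵥ g v.
Proof. exact: tensor_liftE. Qed.

Lemma bilin_assoc_fst U V W (w : W) :
  bilin (fun (u : U) (v : V) => u ⊗ᵥ (v ⊗ᵥ w)).
Proof.
by split=> [v|u] a x y; rewrite ?(bilin_tens _ _).1 ?(bilin_tens _ _).2.
Qed.

Lemma bilin_assoc U V W :
  bilin (fun (t : U ⊗ V) (w : W) => tensor_lift (bilin_assoc_fst U V w) t).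
Proof.
by apply: bilin_lift => u v a w w'; rewrite !(bilin_tens _ _).2.
Qed.

Definition tensor_assoc U V W : {linear (U ⊗ V) ⊗ W -> U ⊗ (V ⊗ W)} :=
  tensor_lift (bilin_assoc U V W).

Lemma tensor_assocE U V W (u : U) (v : V) (w : W) :
  tensor_assoc U V W (u ⊗ᵥ v ⊗ᵥ w) = u ⊗ᵥ (v ⊗ᵥ w).
Proof. by rewrite /tensor_assoc !tensor_liftE. Qed.

Lemma bilin_assocV_snd U V W (u : U) :
  bilin (fun (v : V) (w : W) => u ⊗ᵥ v ⊗ᵥ w).
Proof.
by split=> [v|w] a x y; rewrite ?(bilin_tens _ _).1 ?(bilin_tens _ _).2
  ?(bilin_tens _ _).1.
Qed.

Lemma bilin_assocV U V W :
  bilin (fun (u : U) (t : V ⊗ W) => tensor_lift (bilin_assocV_snd V W u) t).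
Proof.
apply/bilin_flip/bilin_lift => v w a u u'.
by rewrite !(bilin_tens _ _).1.
Qed.

Definition tensor_assocV U V W : {linear U ⊗ (V ⊗ W) -> (U ⊗ V) ⊗ W} :=
  tensor_lift (bilin_assocV U V W).

Lemma tensor_assocVE U V W (u : U) (v : V) (w : W) :
  tensor_assocV U V W (u ⊗ᵥ (v ⊗ᵥ w)) = u ⊗ᵥ v ⊗ᵥ w.
Proof. by rewrite /tensor_assocV !tensor_liftE. Qed.

Definition tensor_flip U V : {linear U ⊗ V -> V ⊗ U} :=
  tensor_lift (bilin_flip (bilin_tens V U)).

Lemma tensor_flipE U V (u : U) (v : V) : tensor_flip U V (u ⊗ᵥ v) = v ⊗ᵥ u.
Proof. exact: tensor_liftE. Qed.

Lemma bilin_scale V : bilin (fun (a : F^o) (v : V) => (a : F) *: v).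
Proof.
split=> [v|a] c x y; first by rewrite scalerDl scalerA.
by rewrite scalerDr !scalerA mulrC.
Qed.

Definition tensor_unitl V : {linear F^o ⊗ V -> V} := tensor_lift (bilin_scale V).

Lemma tensor_unitlE V (a : F^o) (v : V) :
  tensor_unitl V (a ⊗ᵥ v) = (a : F) *: v.
Proof. exact: tensor_liftE. Qed.

Definition tensor_unitr V : {linear V ⊗ F^o -> V} :=
  tensor_lift (bilin_flip (bilin_scale V)).

Lemma tensor_unitrE V (a : F^o) (v : V) :
  tensor_unitr V (v ⊗ᵥ a) = (a : F) *: v.
Proof. exact: tensor_liftE. Qed.

Section FreeTensor.
Variables (R S T : choiceType) (X : lmodType F).

Lemma free_tensor_eq (f g : {linear {malg F[R]} ⊗ {malg F[S]} -> X}) :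
  (forall r s, f (<< r >> ⊗ᵥ << s >>) = g (<< r >> ⊗ᵥ << s >>)) -> f =1 g.
Proof.
move=> fg; apply: tensor_eq => u v.
apply: (@free_eq _ _ _ (slicel f v) (slicel g v)) => r.
by apply: (@free_eq _ _ _ (slicer f << r >>) (slicer g << r >>)) => s; exact: fg.
Qed.

Lemma free_tensor_eq3
    (f g : {linear ({malg F[R]} ⊗ {malg F[S]}) ⊗ {malg F[T]} -> X}) :
  (forall r s t, f (<< r >> ⊗ᵥ << s >> ⊗ᵥ << t >>) =
                 g (<< r >> ⊗ᵥ << s >> ⊗ᵥ << t >>)) -> f =1 g.
Proof.
move=> fg; apply: tensor_eq3 => u v w.
apply: (@free_eq _ _ _ (slicer f (u ⊗ᵥ v)) (slicer g (u ⊗ᵥ v))) => t.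
apply: (@free_eq _ _ _ (slicel (slicel f << t >>) v)
                       (slicel (slicel g << t >>) v)) => r.
apply: (@free_eq _ _ _ (slicer (slicel f << t >>) << r >>)
                       (slicer (slicel g << t >>) << r >>)) => s.
exact: fg.
Qed.

Lemma free_tensor_eq3r
    (f g : {linear {malg F[R]} ⊗ ({malg F[S]} ⊗ {malg F[T]}) -> X}) :
  (forall r s t, f (<< r >> ⊗ᵥ (<< s >> ⊗ᵥ << t >>)) =
                 g (<< r >> ⊗ᵥ (<< s >> ⊗ᵥ << t >>))) -> f =1 g.
Proof.
move=> fg x; rewrite -[x](_ : tensor_assoc _ _ _ (tensor_assocV _ _ _ x) = x).
  have := @free_tensor_eq3 (f \o tensor_assoc _ _ _) (g \o tensor_assoc _ _ _).
  by apply=> r s t; rewrite /= tensor_assocE; exact: fg.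
have := @tensor_eq3r _ _ _ _ (tensor_assoc _ _ _ \o tensor_assocV _ _ _) idfun.
by apply=> u v w; rewrite /= tensor_assocVE tensor_assocE.
Qed.

End FreeTensor.

End TensorMaps.

Notation "f ⊗ₘ g" := (tensor_map f g) (at level 40, left associativity)
  : ring_scope.

(* U ⊗ c ⊗ X between the associated bracketings, c being the flip *)
HB.lock Definition tensor_mid (F : fieldType) (U V W X : lmodType F) :
    {linear (U ⊗ V) ⊗ (W ⊗ X) -> (U ⊗ W) ⊗ (V ⊗ X)} :=
  tensor_assocV U W (V ⊗ X)
  \o ((idfun : {linear U -> U}) ⊗ₘ (tensor_assoc W V X
        \o (tensor_flip V W ⊗ₘ (idfun : {linear X -> X}))
        \o tensor_assocV V W X))
  \o tensor_assoc U V (W ⊗ X).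
Canonical tensor_mid_unlock := Unlockable tensor_mid.unlock.
Arguments tensor_mid {F} U V W X.

Lemma tensor_midE (F : fieldType) (U V W X : lmodType F)
  (u : U) (v : V) (w : W) (x : X) :
  tensor_mid U V W X ((u ⊗ᵥ v) ⊗ᵥ (w ⊗ᵥ x)) = (u ⊗ᵥ w) ⊗ᵥ (v ⊗ᵥ x).
Proof.
rewrite tensor_mid.unlock /= tensor_assocE tensor_mapE /= tensor_assocVE.
by rewrite tensor_mapE tensor_flipE tensor_assocE tensor_assocVE.
Qed.

Section Hopf.
Variable F : fieldType.
Implicit Types V W : lmodType F.

Local Notation "'id_ V" := (@idfun V : {linear V -> V}) (at level 9).

Record coalgebra := Coalgebra {
  coalg_vect :> lmodType F;
  comul : {linear coalg_vect -> coalg_vect ⊗ coalg_vect};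
  counit : {linear coalg_vect -> F^o};
  comulA : tensor_assoc _ _ _ \o (comul ⊗ₘ 'id_coalg_vect) \o comul
           =1 ('id_coalg_vect ⊗ₘ comul) \o comul;
  counitl : tensor_unitl _ \o (counit ⊗ₘ 'id_coalg_vect) \o comul =1 id;
  counitr : tensor_unitr _ \o ('id_coalg_vect ⊗ₘ counit) \o comul =1 id }.

(* The structure maps are arguments, so that this also applies to C ⊗ C and to F *)
Definition coalg_morphism V W
    (dV : {linear V -> V ⊗ V}) (eV : {linear V -> F^o})
    (dW : {linear W -> W ⊗ W}) (eW : {linear W -> F^o})
    (f : {linear V -> W}) : Prop :=
  dW \o f =1 (f ⊗ₘ f) \o dV /\ eW \o f =1 eV.

Definition tens_comul (C : coalgebra) :
    {linear C ⊗ C -> (C ⊗ C) ⊗ (C ⊗ C)} :=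
  tensor_mid C C C C \o (comul C ⊗ₘ comul C).

Definition tens_counit (C : coalgebra) : {linear C ⊗ C -> F^o} :=
  tensor_unitl F^o \o (counit C ⊗ₘ counit C).

Definition base_comul_fun (a : F^o) : F^o ⊗ F^o := a ⊗ᵥ (1 : F^o).

Lemma base_comul_is_linear : linear base_comul_fun.
Proof. by move=> a x y; rewrite /base_comul_fun (bilin_tens _ _).1. Qed.

HB.instance Definition _ := GRing.isLinear.Build F F^o (F^o ⊗ F^o) *:%R
  base_comul_fun base_comul_is_linear.

Definition base_comul : {linear F^o -> F^o ⊗ F^o} := base_comul_fun.

Record hopf_monoid (C : coalgebra) := HopfMonoid {
  hopf_unit : {linear F^o -> C};
  hopf_mul : {linear C ⊗ C -> C};
  hopf_antipode : {linear C -> C};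
  hopf_mulA : hopf_mul \o (hopf_mul ⊗ₘ 'id_C)
              =1 hopf_mul \o ('id_C ⊗ₘ hopf_mul) \o tensor_assoc C C C;
  hopf_mul1l : hopf_mul \o (hopf_unit ⊗ₘ 'id_C) =1 tensor_unitl C;
  hopf_mul1r : hopf_mul \o ('id_C ⊗ₘ hopf_unit) =1 tensor_unitr C;
  hopf_mul_coalg : coalg_morphism (tens_comul C) (tens_counit C)
                     (comul C) (counit C) hopf_mul;
  hopf_unit_coalg : coalg_morphism base_comul 'id_(F^o)
                      (comul C) (counit C) hopf_unit;
  hopf_antipodel : hopf_mul \o (hopf_antipode ⊗ₘ 'id_C) \o comul C
                   =1 hopf_unit \o counit C;
  hopf_antipoder : hopf_mul \o ('id_C ⊗ₘ hopf_antipode) \o comul C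
                   =1 hopf_unit \o counit C }.

Record nu_bimonoid (C : coalgebra) := NuBimonoid {
  nu_mul : {linear C ⊗ C -> C};
  nu_mulA : nu_mul \o (nu_mul ⊗ₘ 'id_C)
            =1 nu_mul \o ('id_C ⊗ₘ nu_mul) \o tensor_assoc C C C;
  nu_mul_coalg : coalg_morphism (tens_comul C) (tens_counit C)
                   (comul C) (counit C) nu_mul }.

Definition hopf_truss_gamma (C : coalgebra) (H1 : hopf_monoid C)
    (H2 : nu_bimonoid C) (sigma : {linear C -> C}) : {linear C ⊗ C -> C} :=
  hopf_mul H1 \o ((hopf_antipode H1 \o sigma) ⊗ₘ nu_mul H2)
  \o tensor_assoc C C C \o (comul C ⊗ₘ 'id_C).

Record hopf_truss := HopfTruss {
  ht_coalg :> coalgebra;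
  ht1 : hopf_monoid ht_coalg;
  ht2 : nu_bimonoid ht_coalg;
  ht_cocycle : {linear ht_coalg -> ht_coalg};
  ht_cocycle_coalg : coalg_morphism (comul ht_coalg) (counit ht_coalg)
                       (comul ht_coalg) (counit ht_coalg) ht_cocycle;
  ht_distr : nu_mul ht2 \o ('id_ht_coalg ⊗ₘ hopf_mul ht1)
             =1 hopf_mul ht1
                \o (nu_mul ht2 ⊗ₘ hopf_truss_gamma ht1 ht2 ht_cocycle)
                \o tensor_mid ht_coalg ht_coalg ht_coalg ht_coalg
                \o (comul ht_coalg ⊗ₘ 'id_(ht_coalg ⊗ ht_coalg)) }.

Record hopf_truss_hom (H B : hopf_truss) := HopfTrussHom {
  hth_fun :> {linear H -> B};
  hth_coalg : coalg_morphism (comul H) (counit H) (comul B) (counit B) hth_fun;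
  hth_unit : hth_fun \o hopf_unit (ht1 H) =1 hopf_unit (ht1 B);
  hth_mul1 : hth_fun \o hopf_mul (ht1 H)
             =1 hopf_mul (ht1 B) \o (hth_fun ⊗ₘ hth_fun);
  hth_mul2 : hth_fun \o nu_mul (ht2 H)
             =1 nu_mul (ht2 B) \o (hth_fun ⊗ₘ hth_fun) }.

(* The span is the image of D ⊗ D in C ⊗ C *)
Definition is_subcoalgebra (C : coalgebra) (D : set C) : Prop :=
  is_subspace D /\
  forall x, D x ->
    lin_span [set t | exists d e, [/\ D d, D e & t = d ⊗ᵥ e]] (comul C x).

Definition simple_subcoalgebra (C : coalgebra) (D : set C) : Prop :=
  [/\ is_subcoalgebra D, D <> [set 0] &
      forall E, is_subcoalgebra E -> E `<=` D -> E = [set 0] \/ E = D].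

Definition one_dimensional V (D : set V) : Prop :=
  exists2 x, x != 0 & D = [set y | exists a : F, y = a *: x].

Definition pointed (C : coalgebra) : Prop :=
  forall D : set C, simple_subcoalgebra D -> one_dimensional D.

Definition coradical (C : coalgebra) : set C :=
  lin_span (\bigcup_(D in @simple_subcoalgebra C) D).

Arguments coradical : clear implicits.

Definition cosemisimple (C : coalgebra) : Prop := coradical C = setT.

Definition pointed_cosemisimple (H : hopf_truss) : Prop :=
  pointed H /\ cosemisimple H.

End Hopf.

Arguments coradical {F} C.

(* The carrier of a groupType is a choiceType; under the classical axioms in use
   this is no restriction on the underlying set. *)
Record skew_truss := SkewTruss {
  st_group :> groupType;
  st_mul2 : st_group -> st_group -> st_group;
  st_cocycle : st_group -> st_group;
  st_mul2A : associative st_mul2;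
  st_distr : forall a b c : st_group,
    st_mul2 a (b * c)%g = (st_mul2 a b * (st_cocycle a)^-1 * st_mul2 a c)%g }.

Record skew_truss_hom (S T : skew_truss) := SkewTrussHom {
  sth_fun :> S -> T;
  sth_mul1 : {morph sth_fun : a b / (a * b)%g};
  sth_mul2 : {morph sth_fun : a b / st_mul2 a b} }.

Record category := Category {
  cat_ob :> Type;
  cat_hom : cat_ob -> cat_ob -> Type;
  cat_id : forall x, cat_hom x x;
  cat_comp : forall x y z, cat_hom y z -> cat_hom x y -> cat_hom x z;
  cat_comp1f : forall x y (f : cat_hom x y), cat_comp (cat_id y) f = f;
  cat_compf1 : forall x y (f : cat_hom x y), cat_comp f (cat_id x) = f;
  cat_compA : forall x y z t
    (h : cat_hom z t) (g : cat_hom y z) (f : cat_hom x y),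
    cat_comp h (cat_comp g f) = cat_comp (cat_comp h g) f }.

Arguments cat_hom {_} x y.
Arguments cat_id {_} x.
Arguments cat_comp {_ x y z} g f.
Notation "g ∘c f" := (cat_comp g f) (at level 40, left associativity).

Record functor (C D : category) := Functor {
  fun_ob :> C -> D;
  fun_hom : forall x y, cat_hom x y -> cat_hom (fun_ob x) (fun_ob y);
  fun_hom1 : forall x, fun_hom (cat_id x) = cat_id (fun_ob x);
  fun_homM : forall x y z (g : cat_hom y z) (f : cat_hom x y),
    fun_hom (g ∘c f) = fun_hom g ∘c fun_hom f }.

Arguments fun_hom {C D} _ {x y} f.

Definition functor_id (C : category) : functor C C :=
  @Functor C C id (fun _ _ f => f) (fun _ => erefl) (fun _ _ _ _ _ => erefl).

Lemma functor_comp_hom1 (C D E : category) (G : functor D E) (F : functor C D) x :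
  fun_hom G (fun_hom F (cat_id x)) = cat_id (G (F x)).
Proof. by rewrite !fun_hom1. Qed.

Lemma functor_comp_homM (C D E : category) (G : functor D E) (F : functor C D)
  x y z (g : cat_hom y z) (f : cat_hom x y) :
  fun_hom G (fun_hom F (g ∘c f)) =
  fun_hom G (fun_hom F g) ∘c fun_hom G (fun_hom F f).
Proof. by rewrite !fun_homM. Qed.

Definition functor_comp (C D E : category) (G : functor D E) (F : functor C D) :
    functor C E :=
  @Functor C E (fun x => G (F x)) (fun _ _ f => fun_hom G (fun_hom F f))
    (functor_comp_hom1 G F) (functor_comp_homM G F).

Record nat_trans (C D : category) (F G : functor C D) := NatTrans {
  nt_comp :> forall x, cat_hom (F x) (G x);
  nt_natural : forall x y (f : cat_hom x y),
    nt_comp y ∘c fun_hom F f = fun_hom G f ∘c nt_comp x }.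

Definition is_iso (C : category) (x y : C) (f : cat_hom x y) : Prop :=
  exists g : cat_hom y x, g ∘c f = cat_id x /\ f ∘c g = cat_id y.

Record adjunction (C D : category) (L : functor C D) (R : functor D C) :=
  Adjunction {
    adj_unit : nat_trans (functor_id C) (functor_comp R L);
    adj_counit : nat_trans (functor_comp L R) (functor_id D);
    adj_triangleL : forall x, adj_counit (L x) ∘c fun_hom L (adj_unit x)
                              = cat_id (L x);
    adj_triangleR : forall y, fun_hom R (adj_counit y) ∘c adj_unit (R y)
                              = cat_id (R y) }.

(* The unit and the counit are natural isomorphisms *)
Definition is_adjoint_equivalence (C D : category) (L : functor C D)
    (R : functor D C) (A : adjunction L R) : Prop :=
  (forall x, is_iso (adj_unit A x)) /\ (forall y, is_iso (adj_counit A y)).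

Section FullSubcategory.
Variables (D : category) (P : D -> Prop).

Definition full_subcat : category :=
  @Category {y : D | P y} (fun y z => cat_hom (sval y) (sval z))
    (fun y => cat_id (sval y)) (fun _ _ _ g f => g ∘c f)
    (fun _ _ => @cat_comp1f D _ _) (fun _ _ => @cat_compf1 D _ _)
    (fun _ _ _ _ => @cat_compA D _ _ _ _).

Definition full_subcat_incl : functor full_subcat D :=
  @Functor full_subcat D (fun y => sval y) (fun _ _ f => f)
    (fun _ => erefl) (fun _ _ _ _ _ => erefl).

Variables (C : category) (L : functor C D) (R : functor D C).
Hypothesis LP : forall x, P (L x).

Definition corestrict : functor C full_subcat :=
  @Functor C full_subcat (fun x => exist _ (L x) (LP x))
    (fun _ _ f => fun_hom L f) (fun_hom1 L) (@fun_homM _ _ L).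

Definition restrict : functor full_subcat C := functor_comp R full_subcat_incl.

Variable A : adjunction L R.

Definition restrict_unit :
    nat_trans (functor_id C) (functor_comp restrict corestrict) :=
  @NatTrans C C (functor_id C) (functor_comp restrict corestrict)
    (adj_unit A) (@nt_natural _ _ _ _ (adj_unit A)).

Definition restrict_counit :
    nat_trans (functor_comp corestrict restrict) (functor_id full_subcat) :=
  @NatTrans full_subcat full_subcat
    (functor_comp corestrict restrict) (functor_id full_subcat)
    (fun y => adj_counit A (sval y))
    (fun y z => @nt_natural _ _ _ _ (adj_counit A) (sval y) (sval z)).

(* L ⊣ R with L corestricted to the full subcategory on P and R restricted to it *)
Definition restrict_adjunction : adjunction corestrict restrict :=
  @Adjunction C full_subcat corestrict restrict restrict_unit restrict_counit
    (adj_triangleL A) (fun y => adj_triangleR A (sval y)).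

End FullSubcategory.

Lemma skew_truss_hom_ext (S T : skew_truss) (f g : skew_truss_hom S T) :
  f =1 g -> f = g.
Proof.
case: f g => [f f1 f2] [g g1 g2] /= fg; have {}fg : f = g by exact: funext.
by subst g; rewrite (Prop_irrelevance f1 g1) (Prop_irrelevance f2 g2).
Qed.

Definition skew_truss_id (T : skew_truss) : skew_truss_hom T T :=
  @SkewTrussHom T T id (fun _ _ => erefl) (fun _ _ => erefl).

Lemma skew_truss_comp_mul1 (S T U : skew_truss) (g : skew_truss_hom T U)
  (f : skew_truss_hom S T) : {morph g \o f : a b / (a * b)%g}.
Proof. by move=> a b; rewrite /= !sth_mul1. Qed.

Lemma skew_truss_comp_mul2 (S T U : skew_truss) (g : skew_truss_hom T U)
  (f : skew_truss_hom S T) : {morph g \o f : a b / st_mul2 a b}.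
Proof. by move=> a b; rewrite /= !sth_mul2. Qed.

Definition skew_truss_comp (S T U : skew_truss) (g : skew_truss_hom T U)
    (f : skew_truss_hom S T) : skew_truss_hom S U :=
  @SkewTrussHom S U (g \o f)
    (skew_truss_comp_mul1 g f) (skew_truss_comp_mul2 g f).

Definition SkTr : category :=
  @Category skew_truss skew_truss_hom skew_truss_id skew_truss_comp
    (fun _ _ f => @skew_truss_hom_ext _ _ (skew_truss_comp (skew_truss_id _) f) f (fun=> erefl))
    (fun _ _ f => @skew_truss_hom_ext _ _ (skew_truss_comp f (skew_truss_id _)) f (fun=> erefl))
    (fun _ _ _ _ h g f => @skew_truss_hom_ext _ _
       (skew_truss_comp h (skew_truss_comp g f)) (skew_truss_comp (skew_truss_comp h g) f)
       (fun=> erefl)).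

Section HTr.
Variable F : fieldType.
Implicit Types H B K : hopf_truss F.

Lemma hopf_truss_hom_ext H B (f g : hopf_truss_hom H B) : f =1 g -> f = g.
Proof.
case: f g => [f f1 f2 f3 f4] [g g1 g2 g3 g4] /= /linear_ext fg; subst g.
by rewrite (Prop_irrelevance f1 g1) (Prop_irrelevance f2 g2)
  (Prop_irrelevance f3 g3) (Prop_irrelevance f4 g4).
Qed.

Lemma tensor_map_id (V W : lmodType F) :
  (idfun : {linear V -> V}) ⊗ₘ (idfun : {linear W -> W}) =1 id.
Proof.
have := @tensor_eq _ _ _ _
  ((idfun : {linear V -> V}) ⊗ₘ (idfun : {linear W -> W})) idfun.
by apply=> u v; rewrite tensor_mapE.
Qed.

Lemma tensor_map_comp (V V' V'' W W' W'' : lmodType F)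
  (g : {linear V' -> V''}) (f : {linear V -> V'})
  (g' : {linear W' -> W''}) (f' : {linear W -> W'}) :
  (g \o f) ⊗ₘ (g' \o f') =1 (g ⊗ₘ g') \o (f ⊗ₘ f').
Proof.
have := @tensor_eq _ _ _ _ ((g \o f) ⊗ₘ (g' \o f')) ((g ⊗ₘ g') \o (f ⊗ₘ f')).
by apply=> u v; rewrite /= !tensor_mapE.
Qed.

Section Identity.
Variable H : hopf_truss F.

Definition hth_id : {linear H -> H} := idfun.

Lemma hth_id_coalg :
  coalg_morphism (comul H) (counit H) (comul H) (counit H) hth_id.
Proof. by split=> x //=; rewrite tensor_map_id. Qed.

Lemma hth_id_unit : hth_id \o hopf_unit (ht1 H) =1 hopf_unit (ht1 H).
Proof. by []. Qed.

Lemma hth_id_mul1 :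
  hth_id \o hopf_mul (ht1 H) =1 hopf_mul (ht1 H) \o (hth_id ⊗ₘ hth_id).
Proof. by move=> x /=; rewrite tensor_map_id. Qed.

Lemma hth_id_mul2 :
  hth_id \o nu_mul (ht2 H) =1 nu_mul (ht2 H) \o (hth_id ⊗ₘ hth_id).
Proof. by move=> x /=; rewrite tensor_map_id. Qed.

Definition hopf_truss_id : hopf_truss_hom H H :=
  HopfTrussHom hth_id_coalg hth_id_unit hth_id_mul1 hth_id_mul2.

End Identity.

Section Composition.
Variables (H B K : hopf_truss F).
Variables (g : hopf_truss_hom B K) (f : hopf_truss_hom H B).

Definition hth_comp : {linear H -> K} := g \o f.

Lemma hth_comp_coalg :
  coalg_morphism (comul H) (counit H) (comul K) (counit K) hth_comp.
Proof.
have [fd fe] := hth_coalg f; have [gd ge] := hth_coalg g.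
split=> x /=; last by rewrite [LHS]ge [LHS]fe.
by rewrite [LHS]gd /= [comul B _]fd /= tensor_map_comp.
Qed.

Lemma hth_comp_unit : hth_comp \o hopf_unit (ht1 H) =1 hopf_unit (ht1 K).
Proof. by move=> x /=; rewrite [f _]hth_unit [LHS]hth_unit. Qed.

Lemma hth_comp_mul1 :
  hth_comp \o hopf_mul (ht1 H) =1 hopf_mul (ht1 K) \o (hth_comp ⊗ₘ hth_comp).
Proof.
by move=> x /=; rewrite [f _]hth_mul1 [LHS]hth_mul1 /= tensor_map_comp.
Qed.

Lemma hth_comp_mul2 :
  hth_comp \o nu_mul (ht2 H) =1 nu_mul (ht2 K) \o (hth_comp ⊗ₘ hth_comp).
Proof.
by move=> x /=; rewrite [f _]hth_mul2 [LHS]hth_mul2 /= tensor_map_comp.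
Qed.

Definition hopf_truss_comp : hopf_truss_hom H K :=
  HopfTrussHom hth_comp_coalg hth_comp_unit hth_comp_mul1 hth_comp_mul2.

End Composition.

Definition HTr : category :=
  @Category (hopf_truss F) (@hopf_truss_hom F) hopf_truss_id hopf_truss_comp
    (fun _ _ f => @hopf_truss_hom_ext _ _ (hopf_truss_comp (hopf_truss_id _) f) f (fun=> erefl))
    (fun _ _ f => @hopf_truss_hom_ext _ _ (hopf_truss_comp f (hopf_truss_id _)) f (fun=> erefl))
    (fun _ _ _ _ h g f => @hopf_truss_hom_ext _ _
       (hopf_truss_comp h (hopf_truss_comp g f)) (hopf_truss_comp (hopf_truss_comp h g) f)
       (fun=> erefl)).

End HTr.

Section Linearization.
Variable F : fieldType.

Section FreeOps.
Variable T : choiceType.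
Local Notation A := {malg F[T]}.

Definition free_map (S : choiceType) (f : T -> S) : {linear A -> {malg F[S]}} :=
  free_lift (fun a => << f a >>).

Lemma free_mapE (S : choiceType) (f : T -> S) a : free_map f << a >> = << f a >>.
Proof. exact: free_liftU. Qed.

Definition free_comul : {linear A -> A ⊗ A} :=
  free_lift (fun a => (<< a >> : A) ⊗ᵥ (<< a >> : A)).

Lemma free_comulE a : free_comul << a >> = << a >> ⊗ᵥ << a >>.
Proof. exact: free_liftU. Qed.

Definition free_counit : {linear A -> F^o} := free_lift (fun a => 1 : F^o).

Lemma free_counitE a : free_counit << a >> = 1.
Proof. exact: free_liftU. Qed.

Definition free_unit_fun (e : T) (c : F^o) : A := (c : F) *: << e >>.

Lemma free_unit_is_linear e : linear (free_unit_fun e).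
Proof. by move=> c x y; rewrite /free_unit_fun scalerDl scalerA. Qed.

HB.instance Definition _ e := GRing.isLinear.Build F F^o A *:%R
  (free_unit_fun e) (free_unit_is_linear e).

Definition free_unit (e : T) : {linear F^o -> A} := free_unit_fun e.

Lemma free_unitE e c : free_unit e c = c *: << e >>.
Proof. by []. Qed.

Section Mul.
Variable op : T -> T -> T.

Lemma bilin_free_mul : bilin (fun u v : A =>
  free_lift (fun a => free_lift (fun b => << op a b >> : A) v) u).
Proof.
split=> [v|u] c x y; first by rewrite linearP.
rewrite /free_lift scaler_sumr -big_split /=; apply: eq_bigr => k _.
rewrite -!/(free_lift _ _) linearP scalerDr !scalerA.
by rewrite mulrC.
Qed.

Definition free_mul : {linear A ⊗ A -> A} := tensor_lift bilin_free_mul.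

Lemma free_mulE a b : free_mul (<< a >> ⊗ᵥ << b >>) = << op a b >>.
Proof. by rewrite /free_mul tensor_liftE !free_liftU. Qed.

End Mul.

Lemma free_comulA :
  tensor_assoc _ _ _ \o (free_comul ⊗ₘ (idfun : {linear A -> A})) \o free_comul
  =1 ((idfun : {linear A -> A}) ⊗ₘ free_comul) \o free_comul.
Proof.
apply: (@free_eq _ _ _
  (tensor_assoc _ _ _ \o (free_comul ⊗ₘ (idfun : {linear A -> A})) \o free_comul)
  (((idfun : {linear A -> A}) ⊗ₘ free_comul) \o free_comul)) => a.
by rewrite /= free_comulE !tensor_mapE free_comulE tensor_assocE.
Qed.

Lemma free_counitl : tensor_unitl _ \o (free_counit ⊗ₘ (idfun : {linear A -> A}))
  \o free_comul =1 id.
Proof.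
apply: (@free_eq _ _ _ (tensor_unitl _ \o
  (free_counit ⊗ₘ (idfun : {linear A -> A})) \o free_comul) idfun) => a.
by rewrite /= free_comulE !tensor_mapE free_counitE tensor_unitlE scale1r.
Qed.

Lemma free_counitr : tensor_unitr _ \o ((idfun : {linear A -> A}) ⊗ₘ free_counit)
  \o free_comul =1 id.
Proof.
apply: (@free_eq _ _ _ (tensor_unitr _ \o
  ((idfun : {linear A -> A}) ⊗ₘ free_counit) \o free_comul) idfun) => a.
by rewrite /= free_comulE !tensor_mapE free_counitE tensor_unitrE scale1r.
Qed.

Definition free_coalgebra : coalgebra F :=
  Coalgebra free_comulA free_counitl free_counitr.

Lemma free_mulA op : associative op ->
  free_mul op \o (free_mul op ⊗ₘ (idfun : {linear A -> A}))
  =1 free_mul op \o ((idfun : {linear A -> A}) ⊗ₘ free_mul op)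
     \o tensor_assoc A A A.
Proof.
move=> opA; apply: (@free_tensor_eq3 _ _ _ _ _
  (free_mul op \o (free_mul op ⊗ₘ (idfun : {linear A -> A})))
  (free_mul op \o ((idfun : {linear A -> A}) ⊗ₘ free_mul op)
     \o tensor_assoc A A A)) => a b c.
by rewrite /= tensor_assocE !tensor_mapE !free_mulE opA.
Qed.

Lemma free_mul_coalg op : coalg_morphism
  (tens_comul free_coalgebra) (tens_counit free_coalgebra)
  free_comul free_counit (free_mul op).
Proof.
split.
  apply: (@free_tensor_eq _ _ _ _ (free_comul \o free_mul op)
    ((free_mul op ⊗ₘ free_mul op) \o tens_comul free_coalgebra)) => a b.
  rewrite /= free_mulE free_comulE /tens_comul /= tensor_mapE !free_comulE.
  rewrite tensor_midE.
  by rewrite tensor_mapE !free_mulE.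
apply: (@free_tensor_eq _ _ _ _ (free_counit \o free_mul op)
  (tens_counit free_coalgebra)) => a b.
rewrite /= free_mulE free_counitE /tens_counit /= tensor_mapE !free_counitE.
by rewrite tensor_unitlE scale1r.
Qed.

End FreeOps.

Section FreeMap.
Variables (S T : choiceType) (f : S -> T).

Lemma free_map_coalg : coalg_morphism
  (@free_comul S) (@free_counit S) (@free_comul T) (@free_counit T) (free_map f).
Proof.
split.
  apply: (@free_eq _ _ _ (@free_comul T \o free_map f)
    ((free_map f ⊗ₘ free_map f) \o @free_comul S)) => a.
  by rewrite /= free_mapE !free_comulE tensor_mapE free_mapE.
apply: (@free_eq _ _ _ (@free_counit T \o free_map f) (@free_counit S)) => a.
by rewrite /= free_mapE !free_counitE.
Qed.

Lemma free_map_mul opS opT : {morph f : a b / opS a b >-> opT a b} ->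
  free_map f \o free_mul opS =1 free_mul opT \o (free_map f ⊗ₘ free_map f).
Proof.
move=> fM; apply: (@free_tensor_eq _ _ _ _ (free_map f \o free_mul opS)
  (free_mul opT \o (free_map f ⊗ₘ free_map f))) => a b.
by rewrite /= tensor_mapE !free_mapE !free_mulE free_mapE fM.
Qed.

Lemma free_map_unit e : free_map f \o free_unit e =1 free_unit (f e).
Proof. by move=> c; rewrite /= linearZ /= free_mapE. Qed.

End FreeMap.

Section FreeTruss.
Variable T : skew_truss.
Local Notation A := {malg F[T]}.
Local Notation idA := (idfun : {linear A -> A}).
Local Notation mul1 := (free_mul (fun a b : T => (a * b)%g)).
Local Notation inv := (free_map (fun a : T => a^-1%g)).
Local Notation eta := (free_unit (1%g : T)).

Lemma free_mul1l : mul1 \o (eta ⊗ₘ idA) =1 tensor_unitl A.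
Proof.
apply: (@tensor_eq _ _ _ _ (mul1 \o (eta ⊗ₘ idA)) (tensor_unitl A)) => c.
apply: (@free_eq _ _ _ (slicer (mul1 \o (eta ⊗ₘ idA)) c)
  (slicer (tensor_unitl A) c)) => a.
rewrite /= !slicerE /= tensor_mapE tensor_unitlE free_unitE tensZl linearZ /=.
by rewrite free_mulE mul1g.
Qed.

Lemma free_mul1r : mul1 \o (idA ⊗ₘ eta) =1 tensor_unitr A.
Proof.
apply: (@tensor_eq _ _ _ _ (mul1 \o (idA ⊗ₘ eta)) (tensor_unitr A)) => u c.
apply: (@free_eq _ _ _ (slicel (mul1 \o (idA ⊗ₘ eta)) c)
  (slicel (tensor_unitr A) c)) => a.
rewrite /= !slicelE /= tensor_mapE tensor_unitrE free_unitE tensZr linearZ /=.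
by rewrite free_mulE mulg1.
Qed.

Lemma free_unit_coalg : coalg_morphism (base_comul F) (idfun : {linear F^o -> F^o})
  (@free_comul T) (@free_counit T) eta.
Proof.
split=> c /=; rewrite linearZ /=.
  by rewrite free_comulE tensor_mapE !free_unitE scale1r tensZl.
by rewrite free_counitE; exact: mulr1.
Qed.

Lemma free_antipodel :
  mul1 \o (inv ⊗ₘ idA) \o @free_comul T =1 eta \o @free_counit T.
Proof.
apply: (@free_eq _ _ _ (mul1 \o (inv ⊗ₘ idA) \o @free_comul T)
  (eta \o @free_counit T)) => a.
rewrite /= free_comulE tensor_mapE free_mapE free_mulE free_counitE.
by rewrite free_unitE mulVg scale1r.
Qed.

Lemma free_antipoder :
  mul1 \o (idA ⊗ₘ inv) \o @free_comul T =1 eta \o @free_counit T.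
Proof.
apply: (@free_eq _ _ _ (mul1 \o (idA ⊗ₘ inv) \o @free_comul T)
  (eta \o @free_counit T)) => a.
rewrite /= free_comulE tensor_mapE free_mapE free_mulE free_counitE.
by rewrite free_unitE mulgV scale1r.
Qed.

Definition free_hopf : hopf_monoid (free_coalgebra T) :=
  @HopfMonoid F (free_coalgebra T) eta mul1 inv
    (free_mulA (@mulgA T)) free_mul1l free_mul1r
    (free_mul_coalg _) free_unit_coalg free_antipodel free_antipoder.

Definition free_nu_bimonoid : nu_bimonoid (free_coalgebra T) :=
  @NuBimonoid F (free_coalgebra T) (free_mul (@st_mul2 T))
    (free_mulA (@st_mul2A T)) (free_mul_coalg _).

Lemma free_distr :
  nu_mul free_nu_bimonoid \o (idA ⊗ₘ hopf_mul free_hopf)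
  =1 hopf_mul free_hopf
     \o (nu_mul free_nu_bimonoid
           ⊗ₘ hopf_truss_gamma free_hopf free_nu_bimonoid
                (free_map (@st_cocycle T)))
     \o tensor_mid A A A A
     \o (@free_comul T ⊗ₘ (idfun : {linear A ⊗ A -> A ⊗ A})).
Proof.
apply: (@free_tensor_eq3r _ _ _ _ _
  (nu_mul free_nu_bimonoid \o (idA ⊗ₘ hopf_mul free_hopf))
  (hopf_mul free_hopf
     \o (nu_mul free_nu_bimonoid
           ⊗ₘ hopf_truss_gamma free_hopf free_nu_bimonoid
                (free_map (@st_cocycle T)))
     \o tensor_mid A A A A
     \o (@free_comul T ⊗ₘ (idfun : {linear A ⊗ A -> A ⊗ A})))) => a b c.
rewrite /= !tensor_mapE /= free_comulE !free_mulE tensor_midE tensor_mapE.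
rewrite /= tensor_mapE free_comulE tensor_assocE tensor_mapE /=.
by rewrite !free_mapE !free_mulE st_distr mulgA.
Qed.

Definition free_truss : hopf_truss F :=
  @HopfTruss F (free_coalgebra T) free_hopf free_nu_bimonoid
    (free_map (@st_cocycle T)) (free_map_coalg _) free_distr.

End FreeTruss.

Section FreeTrussHom.
Variables (S T : skew_truss) (f : skew_truss_hom S T).

Lemma sth1 : f 1%g = 1%g.
Proof. by apply: (mulgI (f 1%g)); rewrite -sth_mul1 !mulg1. Qed.

Lemma free_truss_hom_unit : free_map f \o hopf_unit (ht1 (free_truss S))
  =1 hopf_unit (ht1 (free_truss T)).
Proof. by move=> c; rewrite [LHS]free_map_unit sth1. Qed.

Definition free_truss_hom : hopf_truss_hom (free_truss S) (free_truss T) :=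
  @HopfTrussHom F (free_truss S) (free_truss T) (free_map f)
    (free_map_coalg _) free_truss_hom_unit
    (free_map_mul (sth_mul1 f)) (free_map_mul (sth_mul2 f)).

End FreeTrussHom.

Lemma free_truss_hom1 (T : SkTr) :
  free_truss_hom (cat_id T) = cat_id (free_truss T : HTr F).
Proof.
apply: hopf_truss_hom_ext.
by apply: (@free_eq _ _ _ (free_map _) idfun) => a; rewrite free_mapE.
Qed.

Lemma free_truss_homM (S T U : SkTr) (g : cat_hom T U) (f : cat_hom S T) :
  free_truss_hom (g ∘c f) =
  (free_truss_hom g : cat_hom (free_truss T : HTr F) (free_truss U))
    ∘c (free_truss_hom f : cat_hom (free_truss S : HTr F) _).
Proof.
apply: hopf_truss_hom_ext.
apply: (@free_eq _ _ _ (free_map _) (free_map g \o free_map f)) => a.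
by rewrite /= !free_mapE.
Qed.

Definition P_st : functor SkTr (HTr F) :=
  @Functor SkTr (HTr F) free_truss free_truss_hom
    free_truss_hom1 free_truss_homM.

End Linearization.

Section Grouplike.
Variable F : fieldType.

Definition grouplike (C : coalgebra F) (h : C) : Prop :=
  comul C h = h ⊗ᵥ h /\ counit C h = 1.

Section Closure.
Variable C : coalgebra F.
Implicit Types g h : C.

Lemma tens_comul_grouplike g h : grouplike g -> grouplike h ->
  tens_comul C (g ⊗ᵥ h) = (g ⊗ᵥ h) ⊗ᵥ (g ⊗ᵥ h).
Proof.
by move=> [dg _] [dh _]; rewrite /tens_comul /= tensor_mapE dg dh tensor_midE.
Qed.

Lemma tens_counit_grouplike g h : grouplike g -> grouplike h ->
  tens_counit C (g ⊗ᵥ h) = 1.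
Proof.
move=> [_ eg] [_ eh]; rewrite /tens_counit /= tensor_mapE eg eh tensor_unitlE.
exact: scale1r.
Qed.

Lemma grouplike_mul (m : {linear C ⊗ C -> C}) g h :
  coalg_morphism (tens_comul C) (tens_counit C) (comul C) (counit C) m ->
  grouplike g -> grouplike h -> grouplike (m (g ⊗ᵥ h)).
Proof.
move=> [md me] gg gh; split.
  by rewrite [LHS]md /comp tens_comul_grouplike // tensor_mapE.
by rewrite [LHS]me tens_counit_grouplike.
Qed.

Lemma grouplike_morph (D : coalgebra F) (f : {linear C -> D}) g :
  coalg_morphism (comul C) (counit C) (comul D) (counit D) f ->
  grouplike g -> grouplike (f g).
Proof.
move=> [fd fe] [gd ge]; split; last by rewrite [LHS]fe.
by rewrite [LHS]fd /= gd tensor_mapE.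
Qed.

Variable H : hopf_monoid C.
Local Notation mul := (hopf_mul H).
Local Notation eta := (hopf_unit H).
Local Notation lam := (hopf_antipode H).

Lemma grouplike1 : grouplike (eta 1).
Proof.
have [ed ee] := hopf_unit_coalg H; split; last by rewrite [LHS]ee.
by rewrite [LHS]ed /= /base_comul /= /base_comul_fun tensor_mapE.
Qed.

Lemma hopf_mulxA x y z : mul (mul (x ⊗ᵥ y) ⊗ᵥ z) = mul (x ⊗ᵥ mul (y ⊗ᵥ z)).
Proof.
have := hopf_mulA H (x ⊗ᵥ y ⊗ᵥ z).
by rewrite /= tensor_assocE !tensor_mapE.
Qed.

Lemma hopf_mul1x x : mul (eta 1 ⊗ᵥ x) = x.
Proof.
have := hopf_mul1l H ((1 : F^o) ⊗ᵥ x).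
by rewrite /= tensor_mapE tensor_unitlE scale1r.
Qed.

Lemma hopf_mulx1 x : mul (x ⊗ᵥ eta 1) = x.
Proof.
have := hopf_mul1r H (x ⊗ᵥ (1 : F^o)).
by rewrite /= tensor_mapE tensor_unitrE scale1r.
Qed.

Lemma hopf_mulVx g : grouplike g -> mul (lam g ⊗ᵥ g) = eta 1.
Proof.
move=> [gd ge]; have := hopf_antipodel H g.
by rewrite /= gd ge tensor_mapE.
Qed.

Lemma hopf_mulxV g : grouplike g -> mul (g ⊗ᵥ lam g) = eta 1.
Proof.
move=> [gd ge]; have := hopf_antipoder H g.
by rewrite /= gd ge tensor_mapE.
Qed.

Let mul2 : {linear (C ⊗ C) ⊗ (C ⊗ C) -> C ⊗ C} :=
  (mul ⊗ₘ mul) \o tensor_mid C C C C.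

Let mul2E a b c d :
  mul2 ((a ⊗ᵥ b) ⊗ᵥ (c ⊗ᵥ d)) = mul (a ⊗ᵥ c) ⊗ᵥ mul (b ⊗ᵥ d).
Proof. by rewrite /mul2 /= tensor_midE tensor_mapE. Qed.

Let mul2A (x : C ⊗ C) c d c' d' :
  mul2 (mul2 (x ⊗ᵥ (c ⊗ᵥ d)) ⊗ᵥ (c' ⊗ᵥ d')) =
  mul2 (x ⊗ᵥ (mul (c ⊗ᵥ c') ⊗ᵥ mul (d ⊗ᵥ d'))).
Proof.
have := @tensor_eq _ _ _ _
  (slicel mul2 (c' ⊗ᵥ d') \o slicel mul2 (c ⊗ᵥ d))
  (slicel mul2 (mul (c ⊗ᵥ c') ⊗ᵥ mul (d ⊗ᵥ d'))).
by apply=> a b; rewrite /= !(tensor_midE, tensor_mapE) !hopf_mulxA.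
Qed.

Let comul_mul x y : comul C (mul (x ⊗ᵥ y)) = mul2 (comul C x ⊗ᵥ comul C y).
Proof.
by have [md _] := hopf_mul_coalg H; rewrite [LHS]md /= /tens_comul /= tensor_mapE.
Qed.

Lemma grouplike_antipode g : grouplike g -> grouplike (lam g).
Proof.
move=> gg; have [gd ge] := gg.
have [d1 e1] := grouplike1.
have [_ me] := hopf_mul_coalg H.
split.
  have := mul2A (comul C (lam g)) g g (lam g) (lam g).
  rewrite -gd -comul_mul hopf_mulVx // d1 mul2E !hopf_mul1x hopf_mulxV // => ->.
  have := @tensor_eq _ _ _ _ idfun (slicel mul2 (eta 1 ⊗ᵥ eta 1)).
  by apply=> a b; rewrite /= tensor_midE tensor_mapE !hopf_mulx1.
have := me (lam g ⊗ᵥ g); rewrite /= hopf_mulVx // e1.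
rewrite /tens_counit /= tensor_mapE ge tensor_unitlE.
by rewrite -[RHS]/(_ * _) mulr1.
Qed.

End Closure.

Section GrouplikeTruss.
Variable H : hopf_truss F.

Definition grouplikes : Type := {h : H | `[< grouplike h >]}.

HB.instance Definition _ := Choice.on grouplikes.

Definition gl_val (g : grouplikes) : H := val g.

Lemma gl_valP (g : grouplikes) : grouplike (gl_val g).
Proof. exact/asboolP/(valP g). Qed.

Definition gl_mk (h : H) (hP : grouplike h) : grouplikes :=
  exist _ h (asboolT hP).

Lemma gl_inj : injective gl_val. Proof. exact: val_inj. Qed.

Definition gl_one : grouplikes := gl_mk (grouplike1 (ht1 H)).

Definition gl_mul1 (g h : grouplikes) : grouplikes :=
  gl_mk (grouplike_mul (hopf_mul_coalg (ht1 H)) (gl_valP g) (gl_valP h)).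

Definition gl_mul2 (g h : grouplikes) : grouplikes :=
  gl_mk (grouplike_mul (nu_mul_coalg (ht2 H)) (gl_valP g) (gl_valP h)).

Definition gl_inv (g : grouplikes) : grouplikes :=
  gl_mk (grouplike_antipode (ht1 H) (gl_valP g)).

Definition gl_cocycle (g : grouplikes) : grouplikes :=
  gl_mk (grouplike_morph (ht_cocycle_coalg H) (gl_valP g)).

Lemma gl_mul1A : associative gl_mul1.
Proof. by move=> a b c; apply/gl_inj/esym; exact: hopf_mulxA. Qed.

Lemma gl_mul1x : left_id gl_one gl_mul1.
Proof. by move=> a; apply/gl_inj; exact: hopf_mul1x. Qed.

Lemma gl_mulx1 : right_id gl_one gl_mul1.
Proof. by move=> a; apply/gl_inj; exact: hopf_mulx1. Qed.

Lemma gl_mulVx : left_inverse gl_one gl_inv gl_mul1.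
Proof. by move=> a; apply/gl_inj; exact/hopf_mulVx/gl_valP. Qed.

Lemma gl_mulxV : right_inverse gl_one gl_inv gl_mul1.
Proof. by move=> a; apply/gl_inj; exact/hopf_mulxV/gl_valP. Qed.

HB.instance Definition _ := isGroup.Build grouplikes
  gl_mul1A gl_mul1x gl_mulx1 gl_mulVx gl_mulxV.

Lemma gl_mul2A : associative gl_mul2.
Proof.
move=> a b c; apply/gl_inj/esym.
have := nu_mulA (ht2 H) (gl_val a ⊗ᵥ gl_val b ⊗ᵥ gl_val c).
by rewrite /= tensor_assocE !tensor_mapE.
Qed.

Lemma gl_distr (a b c : grouplikes) :
  gl_mul2 a (b * c)%g = (gl_mul2 a b * (gl_cocycle a)^-1 * gl_mul2 a c)%g.
Proof.
rewrite -mulgA; apply/gl_inj.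
have := @ht_distr F H (gl_val a ⊗ᵥ (gl_val b ⊗ᵥ gl_val c)).
have [ad _] := gl_valP a.
rewrite /= !tensor_mapE ad tensor_midE tensor_mapE /=.
by rewrite tensor_mapE ad tensor_assocE tensor_mapE.
Qed.

Definition gl_truss : skew_truss := SkewTruss gl_mul2A gl_distr.

End GrouplikeTruss.

Section GrouplikeTrussHom.
Variables (H B : hopf_truss F) (f : hopf_truss_hom H B).

Definition gl_map (g : grouplikes H) : grouplikes B :=
  gl_mk (grouplike_morph (hth_coalg f) (gl_valP g)).

Lemma gl_map_mul1 : {morph gl_map : a b / (a * b)%g}.
Proof.
move=> a b; apply/gl_inj.
have := hth_mul1 f (gl_val a ⊗ᵥ gl_val b).
by rewrite /= tensor_mapE.
Qed.

Lemma gl_map_mul2 : {morph gl_map : a b / gl_mul2 a b}.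
Proof.
move=> a b; apply/gl_inj.
have := hth_mul2 f (gl_val a ⊗ᵥ gl_val b).
by rewrite /= tensor_mapE.
Qed.

Definition gl_truss_hom : skew_truss_hom (gl_truss H) (gl_truss B) :=
  @SkewTrussHom (gl_truss H) (gl_truss B) gl_map gl_map_mul1 gl_map_mul2.

End GrouplikeTrussHom.

Lemma gl_truss_hom1 (H : HTr F) :
  gl_truss_hom (cat_id H) = cat_id (gl_truss H : SkTr).
Proof. by apply: skew_truss_hom_ext => g; apply/gl_inj. Qed.

Lemma gl_truss_homM (H B K : HTr F) (g : cat_hom B K) (f : cat_hom H B) :
  gl_truss_hom (g ∘c f) =
  (gl_truss_hom g : cat_hom (gl_truss B : SkTr) (gl_truss K))
    ∘c (gl_truss_hom f : cat_hom (gl_truss H : SkTr) _).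
Proof. by apply: skew_truss_hom_ext => x; apply/gl_inj. Qed.

Definition R_ht : functor (HTr F) SkTr :=
  @Functor (HTr F) SkTr gl_truss gl_truss_hom gl_truss_hom1 gl_truss_homM.

End Grouplike.

(* Main.v *)
(* The unit sends t to the basis vector t of F[T] and the counit F[G(H)] -> H is
   the linear extension of the inclusion. A grouplike element lying in the span
   of a set of grouplikes belongs to that set, so grouplikes are linearly
   independent: hence the counit is injective and the grouplikes of F[T] are
   exactly the elements of T, i.e. the unit is bijective. In a pointed
   cosemisimple coalgebra every simple subcoalgebra is a line spanned by a
   grouplike, and these lines span, so the counit is then surjective. *)
Require Import Defs.
From HB Require Import structures.
From mathcomp Require Import all_boot all_order all_algebra.
From mathcomp Require Import boolp classical_sets finmap monalg.

Set Implicit Arguments.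
Unset Strict Implicit.
Unset Printing Implicit Defensive.

Import GRing.Theory.
Local Open Scope classical_set_scope.
Local Open Scope ring_scope.

(** * Subspaces of a vector space: hyperplanes and separating functionals *)

Section Subspaces.
Variables (F : fieldType) (V : lmodType F).
Implicit Types (D S : set V) (v x y : V) (a : F).

Lemma subspaceD D x y : is_subspace D -> D x -> D y -> D (x + y).
Proof. by move=> [_ DP] Dx Dy; rewrite -[x]scale1r; exact: DP. Qed.

Lemma subspaceZ D a x : is_subspace D -> D x -> D (a *: x).
Proof. by move=> [D0 DP] Dx; rewrite -[_ *: _]addr0; exact: DP. Qed.

Lemma subspace_sum (I : eqType) (r : seq I) (f : I -> V) D :
  is_subspace D -> (forall i, i \in r -> D (f i)) -> D (\sum_(i <- r) f i).
Proof.
move=> DP Df; rewrite big_seq; elim/big_ind: _ => //; first exact: DP.1.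
by move=> x y; exact: subspaceD.
Qed.

Lemma lin_span_sub D S : is_subspace D -> S `<=` D -> lin_span S `<=` D.
Proof.
move=> DP SD _ [s [sS ->]]; apply: subspace_sum => // p /sS/SD.
exact: subspaceZ.
Qed.

Lemma is_subspace_line v : is_subspace [set y | exists a, y = a *: v].
Proof.
split=> [|a _ _ [b ->] [c ->]]; first by exists 0; rewrite scale0r.
by exists (a * b + c); rewrite scalerDl scalerA.
Qed.

(** Zorn's lemma gives a subspace [M] maximal among those that contain [D] and miss [v]. Maximality
    makes it a hyperplane complementary to the line of [v]. *)
Lemma maximal_subspace D v : is_subspace D -> ~ D v ->
  exists M, [/\ is_subspace M, D `<=` M, ~ M v &
    forall x, exists a, M (x - a *: v)].
Proof.
move=> DP Dv.
(* D is put in every member so that the empty chain has an upper bound *)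
pose P (X : set V) := is_subspace (D `|` X) /\ ~ (D `|` X) v.
have [|A [[MP Mv] Amax]] := @Zorn_bigcup _ P.
  move=> E EP Etot; split=> [|[//|[X EX Xv]]]; last first.
    by have [_ []] := EP _ EX; right.
  split=> [|a x y]; first by left; exact: DP.1.
  have inD X w z : E X -> (D `|` X) w -> (D `|` X) z ->
      (D `|` \bigcup_(X in E) X) (a *: w + z).
    move=> EX Dw Dz; have [[_ XP] _] := EP _ EX.
    by case: (XP a w z Dw Dz) => [|Xwz]; [left | right; exists X].
  move=> [Dx|[X EX Xx]] [Dy|[Y EY Yy]].
  - by left; exact: DP.2.
  - by apply: (inD Y) => //; [left | right].
  - by apply: (inD X) => //; [right | left].
  (* The larger of two members of the chain contains both vectors. *)
  - have [XY|YX] := Etot _ _ EX EY.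
      by apply: (inD Y) => //; right => //; exact: XY.
    by apply: (inD X) => //; right => //; exact: YX.
exists (D `|` A); split=> // x.
have [Mx|Mx] := pselect ((D `|` A) x); first by exists 0; rewrite scale0r subr0.
(* For [x] outside the maximal subspace, adjoining [x] gives a strictly larger subspace, which must
   therefore contain [v]. Solving [v = w + a *: x] for [x] yields the coefficient [a^-1]. *)
pose B : set V := [set y | exists2 w, (D `|` A) w & exists a, y = w + a *: x].
have BP : is_subspace B.
  split=> [|a _ _ [w Mw [b ->]] [z Mz [c ->]]].
    by exists 0; [exact: MP.1 | exists 0; rewrite scale0r addr0].
  exists (a *: w + z); first exact: MP.2.
  by exists (a * b + c); rewrite scalerDr scalerDl scalerA addrACA.
have MB : D `|` A `<=` B.
  by move=> w Mw; exists w => //; exists 0; rewrite scale0r addr0.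
have DB : D `|` B = B by apply/setUidPr => w Dw; apply: MB; left.
have [w Mw [a va]] : B v.
  apply: contrapT => Bv; apply: (Amax B); last by rewrite /P DB.
  split=> [w Aw|BA]; first by apply: MB; right.
  apply: Mx; right; apply: BA; exists 0; first exact: MP.1.
  by exists 1; rewrite scale1r add0r.
have a0 : a != 0 by apply: contra_notN Mv => /eqP a0; rewrite va a0 scale0r addr0.
exists a^-1; rewrite va scalerDr scalerA mulVf // scale1r opprD addrCA subrr.
by rewrite addr0 -scaleNr; exact: subspaceZ.
Qed.

(** The functional reads off the coefficient of [v] modulo a hyperplane that contains [D] and misses
    [v]. *)
Lemma separating_functional D v : is_subspace D -> ~ D v ->
  exists phi : {linear V -> F^o}, (forall x, D x -> phi x = 0) /\ phi v = 1.
Proof.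
move=> DP Dv; have [M [MP DM Mv /choice[f fP]]] := maximal_subspace DP Dv.
(* The coefficient is unique, since two different ones would put a nonzero multiple of [v] in [M].
   Linearity of the chosen [f] follows from this uniqueness. *)
have fE x a : M (x - a *: v) -> f x = a.
  move=> Mx; apply: contrapT => /eqP; rewrite -subr_eq0 => fa0; apply: Mv.
  rewrite -[v]scale1r -(mulVf fa0) -scalerA; apply: subspaceZ => //.
  rewrite scalerBl -[f x *: v](subrK x) -addrA addrC; apply: subspaceD => //.
  by rewrite -opprB -scaleN1r; apply: subspaceZ.
have fl : linear (f : V -> F^o).
  move=> a x y; apply: fE.
  rewrite scalerDl -scalerA opprD addrACA -scalerBr; apply: subspaceD => //.
  exact: subspaceZ.
exists (HB.pack_for {linear V -> F^o} (f : V -> F^o)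
  (GRing.isLinear.Build F V F^o *:%R (f : V -> F^o) fl)).
split=> [x Dx|]; apply: fE; first by rewrite scale0r subr0; exact: DM.
by rewrite scale1r subrr; exact: MP.1.
Qed.

End Subspaces.

HB.lock Definition contract (F : fieldType) (U V : lmodType F)
    (phi : {linear U -> F^o}) : {linear U ⊗ V -> V} :=
  tensor_unitl V \o (phi ⊗ₘ (idfun : {linear V -> V})).
Arguments contract {F U} V phi.

Lemma contractE (F : fieldType) (U V : lmodType F) (phi : {linear U -> F^o})
  (u : U) (v : V) : contract V phi (u ⊗ᵥ v) = phi u *: v.
Proof. by rewrite contract.unlock /= tensor_mapE tensor_unitlE. Qed.

(** * Grouplike elements: linear independence and one-dimensional subcoalgebras *)

Section Grouplikes.
Variables (F : fieldType) (C : coalgebra F).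
Implicit Types (S D : set C) (g h x : C).

Lemma grouplike_neq0 g : grouplike g -> g != 0.
Proof.
move=> [_ eg]; apply/eqP => g0; move: eg; rewrite g0 linear0 => /esym/eqP.
by rewrite oner_eq0.
Qed.

(* A functional vanishing on all terms of a linear combination but one, h,
   contracts the coproduct of the combination to a multiple of h. *)
Lemma grouplike_lin_span_mem (s : seq C) g :
  (forall h, h \in s -> grouplike h) -> grouplike g ->
  lin_span [set` s] g -> g \in s.
Proof.
move=> + gg; elim: s => [_ [s [s0 gE]]|h s IH sG].
  have := grouplike_neq0 gg; rewrite gE big_seq big1 ?eqxx // => p /s0.
  by rewrite /= in_nil.
have sG' k (ks : k \in s) : grouplike k by apply: sG; rewrite inE ks orbT.
have {}IH := IH sG'.
have sP := lin_span_subspace [set` s].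
have [sh gs|sh] := pselect (lin_span [set` s] h).
  rewrite inE IH ?orbT //; apply: lin_span_sub gs => // k /=.
  by rewrite inE => /orP[/eqP ->//|]; exact: sub_lin_span.
have [phi [phi0 phi1]] := separating_functional sP sh.
move=> [t [tS gE]].
have [a [w sw {}gE]] : exists a, exists2 w, lin_span [set` s] w & g = a *: h + w.
  have : forall p, p \in t -> p.2 \in h :: s by move=> p /tS.
  rewrite {}gE {tS}; elim: t => [_|p t IHt tS].
    exists 0, 0; first exact: sP.1.
    by rewrite big_nil scale0r addr0.
  have [|a [w sw tE]] := IHt.
    by move=> q qt; apply: tS; rewrite inE qt orbT.
  have := tS p (mem_head _ _); rewrite inE => /orP[/eqP ph|ps].
    by exists (p.1 + a), w => //; rewrite big_cons tE ph scalerDl addrA.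
  exists a, (p.1 *: p.2 + w); last by rewrite big_cons tE addrCA.
  by apply: sP.2 => //; exact: sub_lin_span.
have : contract C phi (comul C g) = phi g *: g by rewrite gg.1 contractE.
have -> : contract C phi (comul C g) = a *: h.
  have [hd _] := sG h (mem_head _ _).
  rewrite gE !linearD !linearZ /= hd contractE phi1 scale1r.
  rewrite [X in _ + X](_ : _ = 0) ?addr0 //.
  apply: (linear_span0 (f := contract C phi \o comul C)) sw => k ks /=.
  have [kd _] := sG' k ks.
  by rewrite kd contractE phi0 ?scale0r //; exact: sub_lin_span.
(* With this value the two computations of the contraction read [a *: h = a *: g]. Either [a]
   cancels, or [a = 0] and [g] already lies in the span of [s]. *)
have phig : phi g = a.
  by rewrite gE linearD linearZ /= phi1 phi0 // addr0; exact: mulr1.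
have [a0|a0] := eqVneq a 0.
  by move=> _; rewrite inE IH ?orbT // gE a0 scale0r add0r.
rewrite phig => /(scalerI a0) <-; exact: mem_head.
Qed.

Lemma grouplike_lin_span S g :
  (forall h, S h -> grouplike h) -> grouplike g -> lin_span S g -> S g.
Proof.
move=> SG gg [s [sS gE]].
have /mapP[p /sS Sp -> //] : g \in [seq p.2 | p <- s].
apply: grouplike_lin_span_mem => // [h /mapP[p /sS/SG pG -> //]|].
exists s; split=> // p ps /=; exact: map_f.
Qed.

(** The coproduct of [g] stays in the tensor square of its line, and any nonzero subspace of a line
    is the whole line. *)
Lemma grouplike_line_simple g : grouplike g ->
  simple_subcoalgebra [set y | exists a : F, y = a *: g].
Proof.
move=> gg; have [gd _] := gg; have g0 := grouplike_neq0 gg; split.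
- split; first exact: is_subspace_line.
  move=> _ [a ->]; rewrite linearZ /= gd; apply: subspaceZ.
    exact: lin_span_subspace.
  by apply: sub_lin_span; exists g, g; split=> //; exists 1; rewrite scale1r.
- move=> /seteqP[+ _] => /(_ g) /= g0'; move/eqP: g0; apply; apply: g0'.
  by exists 1; rewrite scale1r.
- move=> E [EP _] Eg.
  have [E0|/existsNP[x /not_implyP[Ex x0]]] := pselect (forall x, E x -> x = 0).
    by left; apply/seteqP; split=> x /=; [exact: E0 | move=> ->; exact: EP.1].
  right; apply/seteqP; split=> // _ [b ->].
  have [a xE] := Eg _ Ex; have a0 : a != 0.
    by apply/eqP => a0; apply: x0; rewrite xE a0 scale0r.
  rewrite -[g]scale1r -(mulVf a0) -(scalerA a^-1) -xE.
  by apply: subspaceZ => //; exact: subspaceZ.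
Qed.

(** The coproduct of [x] is a sum of tensors with both factors in [D], and contraction leaves
    multiples of the right factors. *)
Lemma subcoalgebra_contract D (phi : {linear C -> F^o}) x :
  is_subcoalgebra D -> D x -> D (contract C phi (comul C x)).
Proof.
move=> [DP DC] /DC [s [sD ->]]; rewrite linear_sum; apply: subspace_sum => // p.
move=> /sD [d [e [_ De ->]]]; rewrite linearZ /= contractE.
by do 2!apply: subspaceZ => //.
Qed.

(** A generator [x] has coproduct [a *: (x ⊗ᵥ x)], and the counit axiom forces [a] times the counit
    of [x] to be 1. Hence [a] is nonzero and the rescaled generator [a *: x] is grouplike. *)
Lemma one_dimensional_subcoalgebra D : is_subcoalgebra D -> one_dimensional D ->
  exists2 g, grouplike g & D = [set y | exists a : F, y = a *: g].
Proof.
move=> [DP DC] [x x0 DE].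
have Dx : D x by rewrite DE; exists 1; rewrite scale1r.
have [a xd] : exists a : F, comul C x = a *: (x ⊗ᵥ x).
  have := lin_span_sub (is_subspace_line (x ⊗ᵥ x)); apply; last exact: DC.
  move=> _ [d [e [Dd De ->]]]; move: Dd De; rewrite DE => -[b ->] [c ->].
  by exists (b * c); rewrite tensZl tensZr scalerA.
have ae : a * (counit C x : F^o) = 1.
  have := counitl x; rewrite /= xd !linearZ /= tensor_mapE tensor_unitlE /=.
  rewrite scalerA -[RHS]scale1r => /eqP; rewrite -subr_eq0 -scalerBl scaler_eq0.
  by rewrite (negPf x0) orbF subr_eq0 => /eqP.
have a0 : a != 0.
  by apply/eqP => a0; move/esym/eqP: ae; rewrite a0 mul0r oner_eq0.
exists (a *: x).
  by split; rewrite linearZ //= xd tensZl tensZr.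
rewrite DE; apply/seteqP; split=> _ [b ->] /=.
  by exists (b / a); rewrite scalerA divfK.
by exists (b * a); rewrite scalerA.
Qed.

Lemma lin_span_grouplike : pointed C -> cosemisimple C ->
  forall x, lin_span (@grouplike F C) x.
Proof.
move=> Cp Cc x; have : coradical C x by rewrite Cc.
apply: lin_span_sub; first exact: lin_span_subspace.
move=> y [D Ds Dy]; have [Dc _ _] := Ds.
have [g gg DE] := one_dimensional_subcoalgebra Dc (Cp _ Ds).
move: Dy; rewrite DE => -[a ->]; apply: subspaceZ; last exact: sub_lin_span.
exact: lin_span_subspace.
Qed.

End Grouplikes.

(** * The coalgebra [F[T]]: its grouplikes, pointedness and cosemisimplicity *)

Section FreeCoalgebra.
Variables (F : fieldType) (T : choiceType).
Local Notation A := {malg F[T]}.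
Local Notation C := (free_coalgebra F T).

Lemma grouplike_malgU (t : T) : @grouplike F C << t >>.
Proof. by split; [exact: free_comulE | exact: free_counitE]. Qed.

Lemma malg_sum (x : A) : x = \sum_(t <- msupp x) x@_t *: << t >>.
Proof.
rewrite {1}[x]monalgE; apply: eq_bigr => t _.
by apply/malgP => k; rewrite mcoeffZ !mcoeffU mulr_natr.
Qed.

Lemma lin_span_malgU (x : A) : lin_span (range (fun t => << t >> : A)) x.
Proof.
rewrite [x]malg_sum; have sP := lin_span_subspace (range (fun t => << t >> : A)).
apply: subspace_sum => // t _; apply: subspaceZ => //; apply: sub_lin_span.
by exists t.
Qed.

Lemma malgU_inj : injective (fun t : T => << t >> : A).
Proof.
move=> s t /malgP/(_ t); rewrite mcoeffUU mcoeffU; case: eqP => // _ /eqP.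
by rewrite eq_sym oner_eq0.
Qed.

Lemma free_grouplike (x : C) : grouplike x -> exists t, x = << t >>.
Proof.
move=> xg.
have [||t _ <-] := @grouplike_lin_span F C (range (fun t => << t >> : A)) x _ xg.
- by move=> _ [t _ <-]; exact: grouplike_malgU.
- exact: lin_span_malgU.
by exists t.
Qed.

(** The coefficient at [t], built with [free_lift] so that it is a linear map to [F^o], as
    [contract] expects. *)
Definition malg_coord (t : T) : {linear A -> F^o} :=
  free_lift (fun s => (s == t)%:R : F^o).

Lemma malg_coordU s t : malg_coord t << s >> = (s == t)%:R.
Proof. exact: free_liftU. Qed.

Lemma malg_coordE t (x : A) : malg_coord t x = x@_t.
Proof.
rewrite [in RHS](malg_sum x) raddf_sum /malg_coord /= /free_lift.
by apply: eq_bigr => s _; rewrite mcoeffZ mcoeffU.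
Qed.

(** Contraction with a coordinate isolates one term of [x], so a subcoalgebra contains every basis
    vector in the support of its elements. *)
Lemma contract_malg_coord t (x : C) :
  contract A (malg_coord t) (comul C x) = x@_t *: << t >>.
Proof.
rewrite -malg_coordE -contractE.
have := @free_eq F T A (contract A (malg_coord t) \o free_comul F T)
  (slicel (contract A (malg_coord t)) << t >>).
apply=> s; rewrite /= slicelE free_comulE !contractE malg_coordU.
by case: eqP => [->|]; rewrite ?scale0r.
Qed.

(** A simple [D] has a nonzero element, hence contains some basis vector. The line of that vector is
    a nonzero subcoalgebra inside [D], so minimality makes it equal to [D]. *)
Lemma pointed_free_coalgebra : pointed C.
Proof.
move=> D [Dc D0 Dmin]; have [DP _] := Dc.
have /existsNP[x /not_implyP[Dx /eqP x0]] : ~ forall x, D x -> x = 0.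
  move=> Dx0; apply: D0; apply/seteqP; split=> x /=; first exact: Dx0.
  by move=> ->; exact: DP.1.
have [t xt] : exists t, (x : A)@_t != 0.
  apply: contrapT => x_0; move/eqP: x0; apply; apply/malgP => t.
  by rewrite mcoeff0; apply: contrapT => /eqP xt; apply: x_0; exists t.
have Dt : D << t >>.
  have -> : << t >> = (x@_t)^-1 *: (x@_t *: << t >>) :> A.
    by rewrite scalerA mulVf // scale1r.
  apply: subspaceZ => //.
  have := @subcoalgebra_contract F C D (malg_coord t) x Dc Dx.
  by rewrite contract_malg_coord.
have tg := grouplike_malgU t.
exists << t >>; first exact: grouplike_neq0 tg.
have [tc tn _] := grouplike_line_simple tg.
have [y [a ->]||/esym //] := Dmin _ tc; first exact: subspaceZ.
by move=> /tn.
Qed.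

Lemma cosemisimple_free_coalgebra : cosemisimple C.
Proof.
apply/seteqP; split=> // x _; have := lin_span_malgU x.
apply: (lin_span_sub (V := A)); first exact: lin_span_subspace.
move=> _ [t _ <-]; apply: sub_lin_span.
exists [set y | exists a : F, y = a *: << t >>].
  exact: grouplike_line_simple (grouplike_malgU t).
by exists 1; rewrite scale1r.
Qed.

End FreeCoalgebra.

(** * The unit of the adjunction *)

Section Unit.
Variables (F : fieldType) (T : skew_truss).
Local Notation A := {malg F[T]}.

Definition unit_fun (t : T) : grouplikes (free_truss F T) :=
  @gl_mk F (free_truss F T) _ (grouplike_malgU F t).

Lemma unit_fun_mul1 : {morph unit_fun : a b / (a * b)%g}.
Proof. by move=> a b; apply/gl_inj/esym; exact: free_mulE. Qed.

Lemma unit_fun_mul2 : {morph unit_fun : a b / st_mul2 a b >-> gl_mul2 a b}.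
Proof. by move=> a b; apply/gl_inj/esym; exact: free_mulE. Qed.

Definition unit_hom : skew_truss_hom T (gl_truss (free_truss F T)) :=
  @SkewTrussHom T (gl_truss (free_truss F T)) unit_fun
    unit_fun_mul1 unit_fun_mul2.

End Unit.

(** * The counit of the adjunction, its injectivity and its surjectivity *)

Section Counit.
Variables (F : fieldType) (H : hopf_truss F).
Local Notation G := (gl_truss H).
Local Notation A := {malg F[G]}.

Definition counit_fun : {linear A -> H} := free_lift (@gl_val F H).

Lemma counit_funE (g : G) : counit_fun << g >> = gl_val g.
Proof. exact: free_liftU. Qed.

Lemma counit_fun_coalg : coalg_morphism
  (@free_comul F G) (@free_counit F G) (comul H) (counit H) counit_fun.
Proof.
split.
  apply: (@free_eq _ _ _ (comul H \o counit_fun)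
    ((counit_fun ⊗ₘ counit_fun) \o @free_comul F G)) => g.
  have [gd _] := gl_valP g.
  by rewrite /= counit_funE gd free_comulE tensor_mapE counit_funE.
apply: (@free_eq _ _ _ (counit H \o counit_fun) (@free_counit F G)) => g.
have [_ ge] := gl_valP g.
by rewrite /= counit_funE ge free_counitE.
Qed.

Lemma counit_fun_unit :
  counit_fun \o hopf_unit (ht1 (free_truss F G)) =1 hopf_unit (ht1 H).
Proof.
(* Writing [c] as [c *: 1] lets linearity reduce the right side to the image of 1. *)
move=> c; rewrite /= linearZ /= counit_funE -[c in RHS]mulr1.
by rewrite -[_ * _]/(c *: (1 : F^o)) linearZ.
Qed.

(** The operation is kept abstract so that both products of the truss are covered. *)
Lemma counit_fun_mul (op : G -> G -> G) (m : {linear H ⊗ H -> H}) :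
  (forall g h, gl_val (op g h) = m (gl_val g ⊗ᵥ gl_val h)) ->
  counit_fun \o free_mul F op =1 m \o (counit_fun ⊗ₘ counit_fun).
Proof.
move=> opE; apply: (@free_tensor_eq _ _ _ _ (counit_fun \o free_mul F op)
  (m \o (counit_fun ⊗ₘ counit_fun))) => g h.
by rewrite /= tensor_mapE free_mulE !counit_funE opE.
Qed.

Definition counit_hom : hopf_truss_hom (free_truss F G) H :=
  @HopfTrussHom F (free_truss F G) H counit_fun counit_fun_coalg
    counit_fun_unit
    (@counit_fun_mul (fun g h => (g * h)%g) (hopf_mul (ht1 H)) (fun _ _ => erefl))
    (@counit_fun_mul (@gl_mul2 F H) (nu_mul (ht2 H)) (fun _ _ => erefl)).

(** A kernel element [z] with a nonzero coefficient at [g] would express [gl_val g] through the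
    other grouplikes. It would then equal one of them, against the injectivity of [gl_val]. *)
Lemma counit_fun_inj : injective counit_fun.
Proof.
move=> x y /eqP; rewrite -subr_eq0 -linearB => /eqP; set z := x - y => z0.
apply/eqP; rewrite -subr_eq0 -/z; apply/eqP/malgP => g; rewrite mcoeff0.
apply: contrapT => /eqP zg0.
pose S := [set gl_val h | h in [set~ g]].
have SP := lin_span_subspace S.
have [||h /= hg /gl_inj//] := @grouplike_lin_span F H S (gl_val g) _ (gl_valP g).
  by move=> _ [h _ <-]; exact: gl_valP.
(* Removing the term at [g] leaves an element supported away from [g], whose image is
   [- z@_g *: gl_val g] because [z] maps to 0. *)
pose w := z - z@_g *: << g >>.
have -> : gl_val g = - (z@_g)^-1 *: counit_fun w.
  by rewrite linearB linearZ /= z0 sub0r counit_funE scaleNr scalerN opprK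
    scalerA mulVf // scale1r.
apply: subspaceZ => //; apply: subspace_sum => // h hw; apply: subspaceZ => //.
apply: sub_lin_span; exists h => // hg; move: hw.
by rewrite -mcoeff_neq0 hg mcoeffB mcoeffZ mcoeffUU mulr1 subrr eqxx.
Qed.

Lemma counit_fun_surj :
  pointed_cosemisimple H -> forall y, exists x, counit_fun x = y.
Proof.
move=> [Hp Hc] y; have [s [sg ->]] := lin_span_grouplike Hp Hc y.
elim: s sg => [_|p s IH sg]; first by exists 0; rewrite linear0 big_nil.
have [|x xs] := IH; first by move=> q qs; apply: sg; rewrite inE qs orbT.
exists (p.1 *: << gl_mk (sg p (mem_head _ _)) >> + x).
by rewrite linearD linearZ /= counit_funE xs big_cons.
Qed.

End Counit.

(** * Bijective morphisms are isomorphisms, for skew trusses and for Hopf trusses *)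

Section Isomorphisms.

Lemma skew_truss_bij_iso (S T : SkTr) (f : cat_hom S T) (g : st_group T -> S) :
  cancel (sth_fun f) g -> cancel g (sth_fun f) -> is_iso f.
Proof.
move=> fK gK.
have g1 : {morph g : a b / (a * b)%g}.
  by move=> a b; apply: (can_inj fK); rewrite sth_mul1 !gK.
have g2 : {morph g : a b / st_mul2 a b}.
  by move=> a b; apply: (can_inj fK); rewrite sth_mul2 !gK.
exists (@SkewTrussHom T S g g1 g2).
by split; apply: skew_truss_hom_ext => x /=; [rewrite fK | rewrite gK].
Qed.

Variable F : fieldType.

Lemma linear_bij_inverse (U V : lmodType F) (f : {linear U -> V}) :
  injective f -> (forall y, exists x, f x = y) ->
  exists g : {linear V -> U}, cancel f g /\ cancel g f.
Proof.
move=> fI /choice[g gK]; have fK : cancel f g by move=> x; apply: fI; rewrite gK.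
have gl : linear g by move=> a x y; apply: fI; rewrite linearP !gK.
by exists (HB.pack_for {linear V -> U} g (GRing.isLinear.Build F V U *:%R g gl)).
Qed.

Lemma tensor_mapK (U V : lmodType F) (f : {linear U -> V}) (g : {linear V -> U}) :
  cancel f g -> cancel (f ⊗ₘ f) (g ⊗ₘ g).
Proof.
move=> fK; apply: (@tensor_eq _ _ _ _ ((g ⊗ₘ g) \o (f ⊗ₘ f)) idfun) => u v.
by rewrite /= !tensor_mapE !fK.
Qed.

(** The linear inverse [g] inherits each compatibility from [f]: apply the one for [f], then cancel
    [f] against [g] and [f ⊗ₘ f] against [g ⊗ₘ g]. *)
Lemma hopf_truss_bij_iso (H B : HTr F) (f : cat_hom H B) :
  injective (hth_fun f) -> (forall y, exists x, hth_fun f x = y) -> is_iso f.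
Proof.
move=> fI /(linear_bij_inverse fI)[g [fK gK]].
have ffK := tensor_mapK fK; have ggK := tensor_mapK gK.
have [fd fe] := hth_coalg f.
have gc : coalg_morphism (comul B) (counit B) (comul H) (counit H) g.
  split=> y /=; rewrite -[in RHS](gK y).
    by rewrite [comul B _]fd /= ffK.
  by rewrite [RHS]fe.
have gu : g \o hopf_unit (ht1 B) =1 hopf_unit (ht1 H).
  by move=> c; apply: fI; rewrite /= gK [RHS]hth_unit.
have g1 : g \o hopf_mul (ht1 B) =1 hopf_mul (ht1 H) \o (g ⊗ₘ g).
  by move=> x; apply: fI; rewrite /= gK [RHS]hth_mul1 /= ggK.
have g2 : g \o nu_mul (ht2 B) =1 nu_mul (ht2 H) \o (g ⊗ₘ g).
  by move=> x; apply: fI; rewrite /= gK [RHS]hth_mul2 /= ggK.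
exists (@HopfTrussHom F B H g gc gu g1 g2).
by split; apply: hopf_truss_hom_ext => x /=; [exact: fK | exact: gK].
Qed.

End Isomorphisms.

(** * Naturality, the triangle identities and the equivalence *)

Section Adjunction.
Variable F : fieldType.

Lemma unit_natural (S T : SkTr) (f : cat_hom S T) :
  (unit_hom F T : cat_hom (T : SkTr) (R_ht F (P_st F T))) ∘c f =
  fun_hom (R_ht F) (fun_hom (P_st F) f)
    ∘c (unit_hom F S : cat_hom (S : SkTr) (R_ht F (P_st F S))).
Proof.
by apply: skew_truss_hom_ext => t; apply/gl_inj/esym; exact: free_mapE.
Qed.

(** Both sides are linear on a free vector space, and each sends the basis vector of a grouplike [g]
    to the image of [g] under [f]. *)
Lemma counit_natural (H B : HTr F) (f : cat_hom H B) :
  (counit_hom B : cat_hom (P_st F (R_ht F B)) B)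
    ∘c fun_hom (P_st F) (fun_hom (R_ht F) f) =
  f ∘c (counit_hom H : cat_hom (P_st F (R_ht F H)) H).
Proof.
apply: hopf_truss_hom_ext.
apply: (@free_eq _ _ _ (counit_fun B \o free_map F (gl_map f))
  (hth_fun f \o counit_fun H)) => g.
by rewrite /= free_mapE !counit_funE.
Qed.

Definition truss_unit :
    nat_trans (functor_id SkTr) (functor_comp (R_ht F) (P_st F)) :=
  @NatTrans _ _ (functor_id SkTr) (functor_comp (R_ht F) (P_st F))
    (@unit_hom F) unit_natural.

Definition truss_counit :
    nat_trans (functor_comp (P_st F) (R_ht F)) (functor_id (HTr F)) :=
  @NatTrans _ _ (functor_comp (P_st F) (R_ht F)) (functor_id (HTr F))
    (@counit_hom F) counit_natural.

Lemma truss_triangleL (T : SkTr) :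
  truss_counit (P_st F T) ∘c fun_hom (P_st F) (truss_unit T)
  = cat_id (P_st F T).
Proof.
apply: hopf_truss_hom_ext.
apply: (@free_eq F T {malg F[T]}
  (counit_fun (free_truss F T) \o free_map F (@unit_fun F T)) idfun) => t.
by rewrite /= free_mapE counit_funE.
Qed.

Lemma truss_triangleR (H : HTr F) :
  fun_hom (R_ht F) (truss_counit H) ∘c truss_unit (R_ht F H)
  = cat_id (R_ht F H).
Proof.
by apply: skew_truss_hom_ext => g; apply/gl_inj; exact: counit_funE.
Qed.

Definition truss_adjunction : adjunction (P_st F) (R_ht F) :=
  Adjunction truss_triangleL truss_triangleR.

End Adjunction.

Theorem theorem2p20 (F : fieldType) :
  exists (A : adjunction (P_st F) (R_ht F))
         (PT : forall T : SkTr, pointed_cosemisimple (P_st F T)),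
    is_adjoint_equivalence (restrict_adjunction PT A).
Proof.
exists (truss_adjunction F).
exists (fun T : skew_truss =>
  conj (@pointed_free_coalgebra F T) (@cosemisimple_free_coalgebra F T)).
split=> [T|[H HP]].
  (* The inverse of the unit chooses, for each grouplike element, the [t] whose basis vector it
     is. *)
  have /choice[g gE] : forall h : gl_truss (free_truss F T),
      exists t : T, gl_val h = << t >>.
    by move=> h; exact: free_grouplike (gl_valP h).
  apply: (@skew_truss_bij_iso _ _ (unit_hom F T) g) => [t|h].
    by apply: (@malgU_inj F); rewrite -gE.
  by apply/gl_inj/esym; exact: gE.
(* The subcategory is full, so an inverse found among all Hopf trusses is also an inverse there. *)
have [k [kl kr]] : is_iso (counit_hom H : cat_hom (P_st F (R_ht F H)) H).
  apply: hopf_truss_bij_iso; first exact: counit_fun_inj.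
  exact: counit_fun_surj.
by exists k.
Qed.
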